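(* Let $k$ be a field. The strict symmetric monoidal functor $K\colon \mathrm{FinCorel}\to\mathrm{FinRel}_k$ maps any morphism $f\colon m\to n$ in $\mathrm{FinCorel}$ to a Lagrangian linear relation $K(f)$ from $(k\oplus k)^m$ to $(k\oplus k)^n$. It thus defines a morphism of props $$K\colon \mathrm{FinCorel}\to\mathrm{LagRel}_k.$$
   Context: A prop is a strict symmetric monoidal category with objects the natural numbers and tensor product of objects given by addition; a morphism of props is a strict symmetric monoidal functor that is the identity on objects. $\mathrm{FinCorel}$ is the prop whose morphisms $m\to n$ are corelations, i.e. partitions of the disjoint union of an $m$-element set and an $n$-element set, composed by gluing along the middle set (elements of the outer sets lie in the same part iff joined by a path); tensor is disjoint union. It is generated by the one-part corelations $m\colon 2\to1$, $i\colon 0\to1$, $d\colon1\to2$, $e\colon1\to0$, subject to the laws of an extraspecial commutative Frobenius monoid. $\mathrm{FinRel}_k$ is the prop whose morphisms $m\to n$ are linear relations from $k^m$ to $k^n$, i.e. linear subspaces of $k^m\oplus k^n$, with usual composition of relations and direct sum as tensor. $K$ is the strict symmetric monoidal functor with $K(1)=2$ (the space $k\oplus k$ with coordinates $(\phi,I)$) determined by $K(m)=\{(\phi_1,I_1,\phi_2,I_2,\phi_3,I_3): \phi_1=\phi_2=\phi_3,\ I_1+I_2=I_3\}$, $K(d)=\{(\phi_1,I_1,\phi_2,I_2,\phi_3,I_3): \phi_1=\phi_2=\phi_3,\ I_1=I_2+I_3\}$, $K(i)=\{(\phi_2,I_2): I_2=0\}$, $K(e)=\{(\phi_1,I_1):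 I_1=0\}$. A symplectic vector space is a finite-dimensional vector space with a bilinear, alternating, nondegenerate form $\omega$; its conjugate $\overline V$ has form $-\omega$. A subspace is isotropic if $\omega$ vanishes on it, and Lagrangian if it is isotropic and not properly contained in another isotropic subspace (equivalently isotropic of half the dimension). $k\oplus k$ has $\omega((\phi,I),(\phi',I'))=\phi I'-\phi' I$, and $(k\oplus k)^n$ the direct sum form. A linear Lagrangian relation from $V$ to $V'$ is a Lagrangian subspace of $\overline V\oplus V'$. $\mathrm{LagRel}_k$ is the prop whose morphisms $m\to n$ are linear Lagrangian relations from $(k\oplus k)^m$ to $(k\oplus k)^n$, with relation composition and direct sum. *)

(* Defs.v *)
From HB Require Import structures.
From mathcomp Require Import all_boot all_order all_algebra.
From mathcomp Require Import boolp.

Set Implicit Arguments.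
Unset Strict Implicit.
Unset Printing Implicit Defensive.

Import GRing.Theory.

(* Strictness equates morphisms whose source and target are only provably
   equal, e.g. (m + n) + p and m + (n + p); [hcast] transports along such
   equations. *)
Definition hcast (H : nat -> nat -> Type) m m' n n'
    (em : m = m') (en : n = n') (f : H m n) : H m' n' :=
  ecast x (H x n') em (ecast y (H m y) en f).
Arguments hcast {H m m' n n'} em en f.

(* Composition [pcomp] is in diagrammatic order. *)
Record prop := MkProp {
  phom :> nat -> nat -> Type;
  pid : forall n, phom n n;
  pcomp : forall m n p, phom m n -> phom n p -> phom m p;
  ptens : forall m n m' n',
    phom m n -> phom m' n' -> phom (m + m') (n + n');
  pbraid : forall m n, phom (m + n) (n + m);
  pcompA : forall m n p q (f : phom m n) (g : phom n p) (h : phom p q),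
    pcomp f (pcomp g h) = pcomp (pcomp f g) h;
  pcomp1f : forall m n (f : phom m n), pcomp (pid m) f = f;
  pcompf1 : forall m n (f : phom m n), pcomp f (pid n) = f;
  ptens_id : forall m n, ptens (pid m) (pid n) = pid (m + n);
  ptens_comp : forall m n p m' n' p' (f : phom m n) (g : phom n p)
      (f' : phom m' n') (g' : phom n' p'),
    ptens (pcomp f g) (pcomp f' g') = pcomp (ptens f f') (ptens g g');
  ptensA : forall m n m' n' m'' n''
      (f : phom m n) (g : phom m' n') (h : phom m'' n''),
    hcast (addnA m m' m'') (addnA n n' n'') (ptens f (ptens g h))
      = ptens (ptens f g) h;
  ptens0f : forall m n (f : phom m n),
    hcast (add0n m) (add0n n) (ptens (pid 0) f) = f;
  ptensf0 : forall m n (f : phom m n),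
    hcast (addn0 m) (addn0 n) (ptens f (pid 0)) = f;
  pbraid_nat : forall m n m' n' (f : phom m n) (g : phom m' n'),
    pcomp (ptens f g) (pbraid n n') = pcomp (pbraid m m') (ptens g f);
  pbraidK : forall m n, pcomp (pbraid m n) (pbraid n m) = pid (m + n);
  pbraid_hex : forall m n p,
    pbraid m (n + p) =
    pcomp (hcast (esym (addnA m n p)) (esym (addnA n m p))
             (ptens (pbraid m n) (pid p)))
          (hcast (erefl (n + (m + p))) (addnA n p m)
             (ptens (pid n) (pbraid m p)))
}.
Arguments pid : clear implicits.
Arguments pbraid : clear implicits.

(* The action on objects is the parameter [ob].  Strictness makes it additive,
   so it is determined by [ob 1]: [ob 1 = 2] means [ob n = n * 2]. *)
Record smfunctor (C D : prop) (ob : nat -> nat) := MkFunctor {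
  fhom :> forall m n, C m n -> D (ob m) (ob n);
  fob0 : ob 0 = 0;
  fobD : forall m n, ob (m + n) = ob m + ob n;
  fhom_id : forall n, fhom (pid C n) = pid D (ob n);
  fhom_comp : forall m n p (f : C m n) (g : C n p),
    fhom (pcomp f g) = pcomp (fhom f) (fhom g);
  fhom_tens : forall m n m' n' (f : C m n) (g : C m' n'),
    hcast (fobD m m') (fobD n n') (fhom (ptens f g))
      = ptens (fhom f) (fhom g);
  fhom_braid : forall m n,
    hcast (fobD m n) (fobD n m) (fhom (pbraid C m n))
      = pbraid D (ob m) (ob n)
}.
Arguments fhom {C D ob} s {m n} f.

Definition prop_morphism (C D : prop) := smfunctor C D id.

Section Corel.
Variables A B : finType.

Definition corel := {P : {set {set A + B}} | partition P [set: A + B]}.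

Definition same_part (f : corel) (x y : A + B) := y \in pblock (val f) x.

Lemma same_equiv f : equivalence_rel (same_part f).
Proof.
move: (valP f) => /= /and3P[/eqP cP tP _] x y z; rewrite /same_part.
have cov t : t \in cover (val f) by rewrite cP inE.
by split=> [|h]; rewrite ?mem_pblock // (same_pblock tP h).
Qed.

Definition corel_of (e : rel (A + B)) (he : equivalence_rel e) : corel :=
  exist _ (equivalence_partition e setT)
    (equivalence_partitionP (in3W he)).

Lemma same_corel_of e he : same_part (@corel_of e he) =2 e.
Proof.
by move=> x y; rewrite /same_part /= pblock_equivalence_partition ?inE //;
   apply: in3W.
Qed.

Fact kernel_equiv (T : eqType) (c : A + B -> T) :
  equivalence_rel [rel x y | c x == c y].
Proof. by move=> x y z; split=> //= /eqP->. Qed.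

Definition corel_kernel (T : eqType) (c : A + B -> T) : corel :=
  corel_of (kernel_equiv c).

Lemma same_kernel T c x y :
  same_part (@corel_kernel T c) x y = (c x == c y).
Proof. exact: same_corel_of. Qed.

Lemma corel_same_inj (f g : corel) : same_part f =2 same_part g -> f = g.
Proof.
move=> h; apply: val_inj => /=.
rewrite -(equivalence_partition_pblock (valP f)).
rewrite -(equivalence_partition_pblock (valP g)).
apply: eq_imset => x; apply/setP=> y; rewrite !inE; exact: h.
Qed.

Lemma same_refl f x : same_part f x x.
Proof. by case: (same_equiv f x x x). Qed.
Lemma same_sym f x y : same_part f x y = same_part f y x.
Proof.
apply/idP/idP => h.
  by have [_ /(_ h) <-] := same_equiv f x y x; rewrite same_refl.
by have [_ /(_ h) <-] := same_equiv f y x y; rewrite same_refl.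
Qed.
Lemma same_trans f y x z : same_part f x y -> same_part f y z -> same_part f x z.
Proof. by move=> h; have [_ ->] := same_equiv f x y z. Qed.

End Corel.

Section Glue.
Variables (A B C : finType) (f : corel A B) (g : corel B C).

Definition glue_left (s : A + B) : A + B + C := inl s.
Definition glue_right (t : B + C) : A + B + C :=
  match t with inl b => inl (inr b) | inr c => inr c end.
Definition glue_outer (s : A + C) : A + B + C :=
  match s with inl a => inl (inl a) | inr c => inr c end.

(* The graph on A + B + C linking two points lying in a common part of f,
   or in a common part of g. *)
Definition glue_edge (x y : A + B + C) : bool :=
  [exists s, exists t, [&& same_part f s t, x == glue_left s & y == glue_left t]]
  || [exists s, exists t,
        [&& same_part g s t, x == glue_right s & y == glue_right t]].

Lemma glue_edge_sym : symmetric glue_edge.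
Proof.
suff h x y : glue_edge x y -> glue_edge y x by move=> x y; apply/idP/idP; apply: h.
case/orP=> /existsP[s /existsP[t /and3P[h h1 h2]]]; apply/orP; [left|right];
by apply/existsP; exists t; apply/existsP; exists s; rewrite same_sym h h1 h2.
Qed.

Fact glue_equiv :
  equivalence_rel [rel s t | connect glue_edge (glue_outer s) (glue_outer t)].
Proof.
move=> x y z; split=> /= [|h]; first exact: connect0.
exact: same_connect (sym_connect_sym glue_edge_sym) _ _ h _.
Qed.

Definition corel_comp : corel A C := corel_of glue_equiv.

End Glue.

(* Two-colourings constant on the parts of a corelation determine it, and
   turn gluing into composition of relations. *)
Section Compat.
Variables A B : finType.
Implicit Types f g : corel A B.

Definition colsum (T : Type) (a : A -> T) (b : B -> T) (x : A + B) : T :=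
  match x with inl i => a i | inr j => b j end.

Definition compat (T : Type) f (a : A -> T) (b : B -> T) :=
  forall x y, same_part f x y -> colsum a b x = colsum a b y.

Lemma compat_inj f g :
  (forall a b : _ -> bool, compat f a b <-> compat g a b) -> f = g.
Proof.
suff h f1 g1 : (forall a b : _ -> bool, compat g1 a b -> compat f1 a b) ->
    forall x y, same_part f1 x y -> same_part g1 x y.
  move=> fg; apply: corel_same_inj => x y.
  by apply/idP/idP; apply: h => a b; apply fg.
move=> fg x y xy.
pose a i := same_part g1 x (inl i); pose b j := same_part g1 x (inr j).
have e z : colsum a b z = same_part g1 x z by case: z.
have cg : compat g1 a b.
  move=> z t zt; rewrite !e; apply/idP/idP => h; first exact: same_trans h zt.
  by apply: (same_trans h); rewrite same_sym.
by rewrite -e -(fg _ _ cg _ _ xy) e same_refl.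
Qed.

Lemma eq_compat T f (a a' : A -> T) (b b' : B -> T) :
  a =1 a' -> b =1 b' -> compat f a b <-> compat f a' b'.
Proof. by move=> /funext-> /funext->. Qed.

Lemma compat_kernel T (U : eqType) (c : A + B -> U) (a : A -> T) (b : B -> T) :
  compat (corel_kernel c) a b <->
  forall x y, c x = c y -> colsum a b x = colsum a b y.
Proof.
split=> h x y; first by move=> e; apply: h; rewrite same_kernel e.
by rewrite same_kernel => /eqP; apply: h.
Qed.

End Compat.

Lemma compat_comp (A B C : finType) (T : Type) (f : corel A B) (g : corel B C)
    (t0 : T) (a : A -> T) (c : C -> T) :
  compat (corel_comp f g) a c <-> exists b, compat f a b /\ compat g b c.
Proof.
split=> [h|[b [hf hg]] x y]; last first.
  pose col (z : A + B + C) :=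
    match z with inl s => colsum a b s | inr k => c k end.
  have colr s : col (glue_right _ s) = colsum b c s by case: s.
  have edge u v : glue_edge f g u v -> col u = col v.
    case/orP=> /existsP[s /existsP[t /and3P[st /eqP-> /eqP->]]].
      exact: hf.
    by rewrite !colr; exact: hg.
  have colo s : col (glue_outer _ s) = colsum a c s by case: s.
  rewrite same_corel_of /= -!colo => /connectP[p].
  elim: p (glue_outer B x) => [|u q IHq] v /=; first by move=> _ ->.
  by case/andP=> /edge -> /IHq h /h.
pose b j := match [pick s : A + C | connect (glue_edge f g)
    (glue_outer B s) (inl (inr j))] with Some s => colsum a c s | None => t0 end.
pose col (z : A + B + C) :=
  match z with inl s => colsum a b s | inr k => c k end.
have csym := sym_connect_sym (glue_edge_sym f g).
have outer s u : connect (glue_edge f g) (glue_outer B s) u ->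
    col u = colsum a c s.
  have o t : connect (glue_edge f g) (glue_outer B s) (glue_outer B t) ->
      colsum a c t = colsum a c s.
    by move=> st; apply/esym/h; rewrite same_corel_of.
  case: u => [[i|j]|k] su /=; [exact: (o (inl i))| |exact: (o (inr k))].
  rewrite /b; case: pickP => [t tj|/(_ s)]; last by rewrite su.
  by apply: o; apply: connect_trans su _; rewrite csym.
have edge u v : glue_edge f g u v -> col u = col v.
  move=> /connect1 uv.
  have [[s su]|no] := pselect (exists s, connect (glue_edge f g) (glue_outer B s) u).
    by rewrite (outer s) // (outer s) //; apply: connect_trans su uv.
  have in_mid w : connect (glue_edge f g) u w -> col w = t0.
    case: w => [[i|j]|k] uw.
    - by case: no; exists (inl i); rewrite csym.
    - rewrite /= /b; case: pickP => // s sj; case: no; exists s.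
      by apply: connect_trans sj _; rewrite csym.
    - by case: no; exists (inr k); rewrite csym.
  by rewrite !in_mid.
exists b; split=> x y xy.
  apply: (edge (inl x) (inl y)); apply/orP; left.
  by apply/existsP; exists x; apply/existsP; exists y; rewrite xy !eqxx.
have colr s : col (glue_right _ s) = colsum b c s by case: s.
rewrite -!colr; apply: edge; apply/orP; right.
by apply/existsP; exists x; apply/existsP; exists y; rewrite xy !eqxx.
Qed.

Lemma split_lshift m n (i : 'I_m) : split (lshift n i) = inl i.
Proof. exact: (unsplitK (inl i)). Qed.
Lemma split_rshift m n (i : 'I_n) : split (rshift m i) = inr i.
Proof. exact: (unsplitK (inr i)). Qed.

Section FinCorel.

Notation cor m n := (corel 'I_m 'I_n).

Definition corel_id n : cor n n :=
  corel_kernel (fun x => match x with inl i => i | inr j => j end).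

Definition tens_index m n m' n' (x : 'I_(m + m') + 'I_(n + n')) :
    ('I_m + 'I_n) + ('I_m' + 'I_n') :=
  match x with
  | inl i => match split i with inl a => inl (inl a) | inr a => inr (inl a) end
  | inr j => match split j with inl b => inl (inr b) | inr b => inr (inr b) end
  end.

Section Tens.
Variables (m n m' n' : nat) (f : cor m n) (g : cor m' n').

Definition tens_rel (x y : 'I_(m + m') + 'I_(n + n')) : bool :=
  match tens_index x, tens_index y with
  | inl s, inl t => same_part f s t
  | inr s, inr t => same_part g s t
  | _, _ => false
  end.

Fact tens_rel_equiv : equivalence_rel tens_rel.
Proof.
move=> x y z; rewrite /tens_rel.
case: (tens_index x) (tens_index y) (tens_index z) => [s|s] [t|t] [r|r];
  split=> //; rewrite ?same_refl //;
  [exact: (same_equiv f s t r).2|exact: (same_equiv g s t r).2].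
Qed.

Definition corel_tens : cor (m + m') (n + n') := corel_of tens_rel_equiv.

Lemma compat_tens T (a : _ -> T) (b : _ -> T) :
  compat corel_tens a b <->
  compat f (a \o @lshift m m') (b \o @lshift n n') /\
  compat g (a \o @rshift m m') (b \o @rshift n n').
Proof.
have e x : colsum a b x = match tens_index x with
    | inl s => colsum (a \o @lshift m m') (b \o @lshift n n') s
    | inr s => colsum (a \o @rshift m m') (b \o @rshift n n') s end.
  by case: x => i /=; case: splitP => j ij /=; congr (_ _); apply: val_inj.
split=> [h|[hf hg] x y].
  pose il (s : 'I_m + 'I_n) : 'I_(m + m') + 'I_(n + n') :=
    match s with inl i => inl (lshift _ i) | inr i => inr (lshift _ i) end.
  pose ir (s : 'I_m' + 'I_n') : 'I_(m + m') + 'I_(n + n') :=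
    match s with inl i => inl (rshift _ i) | inr i => inr (rshift _ i) end.
  have tl s : tens_index (il s) = inl s by case: s => i /=; rewrite split_lshift.
  have tr s : tens_index (ir s) = inr s by case: s => i /=; rewrite split_rshift.
  split=> x y xy.
    have := h (il x) (il y); rewrite same_corel_of /tens_rel !e !tl; exact.
  have := h (ir x) (ir y); rewrite same_corel_of /tens_rel !e !tr; exact.
rewrite same_corel_of /tens_rel !e.
by case: (tens_index x) (tens_index y) => s [] t //; [exact: (hf s t)|exact: (hg s t)].
Qed.

End Tens.

(* The braiding joins i < m (resp. m + j) on the left with n + i (resp. j)
   on the right. *)
Definition braid_wire m n (x : 'I_(m + n) + 'I_(n + m)) : 'I_m + 'I_n :=
  match x with
  | inl i => split i
  | inr j => match split j with inl b => inr b | inr a => inl a end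
  end.

Definition corel_braid m n : cor (m + n) (n + m) := corel_kernel (@braid_wire m n).

Lemma compat_id T n (a b : 'I_n -> T) : compat (corel_id n) a b <-> a =1 b.
Proof.
rewrite compat_kernel; split=> [h i|ab]; first exact: (h (inl i) (inr i)).
by case=> i [] j /= ->.
Qed.

Lemma compat_braid T m n (a b : _ -> T) : compat (corel_braid m n) a b <->
  (a \o @lshift m n =1 b \o @rshift n m) /\ (a \o @rshift m n =1 b \o @lshift n m).
Proof.
rewrite compat_kernel; split=> [h|[h1 h2]].
  split=> i /=.
    by apply: (h (inl (lshift n i)) (inr (rshift n i)));
      rewrite /= split_lshift split_rshift.
  by apply: (h (inl (rshift m i)) (inr (lshift m i)));
    rewrite /= split_lshift split_rshift.
pose w (z : 'I_m + 'I_n) : T :=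
  match z with inl i => a (lshift n i) | inr j => a (rshift m j) end.
suff e x : colsum a b x = w (braid_wire x) by move=> x y; rewrite !e => ->.
case: x => i /=; case: splitP => j ij /=.
- by congr a; apply: val_inj.
- by congr a; apply: val_inj.
- by rewrite -[RHS]/((a \o @rshift m n) j) h2 /=; congr b; apply: val_inj.
- by rewrite -[RHS]/((a \o @lshift m n) j) h1 /=; congr b; apply: val_inj.
Qed.

Lemma compat_cast T m n m' n' (em : m = m') (en : n = n') (f : cor m n)
    (a b : _ -> T) :
  compat (hcast (H := fun m n => cor m n) em en f) a b <->
  compat f (a \o cast_ord em) (b \o cast_ord en).
Proof.
by case: m' / em a; case: n' / en b => b a; apply: eq_compat => i /=;
  rewrite cast_ord_id.
Qed.

(* For m = n = 0 this is the empty partition. *)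
Definition one_part m n : cor m n := corel_kernel (fun _ => tt).

Section FinCorelLaws.
Lemma corel_compA m n p q (f : cor m n) (g : cor n p) (h : cor p q) :
  corel_comp f (corel_comp g h) = corel_comp (corel_comp f g) h.
Proof.
apply: compat_inj => a d; rewrite !(compat_comp _ _ true); split.
  case=> b [fb /(compat_comp _ _ true)[c [gc hd]]].
  by exists c; split=> //; rewrite (compat_comp _ _ true); exists b.
case=> c [/(compat_comp _ _ true)[b [fb gc]] hd].
by exists b; split=> //; rewrite (compat_comp _ _ true); exists c.
Qed.

Lemma corel_comp1f m n (f : cor m n) : corel_comp (corel_id m) f = f.
Proof.
apply: compat_inj => a c; rewrite (compat_comp _ _ true); split.
  by case=> b [/compat_id/funext->].
by exists a; rewrite compat_id.
Qed.

Lemma corel_compf1 m n (f : cor m n) : corel_comp f (corel_id n) = f.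
Proof.
apply: compat_inj => a c; rewrite (compat_comp _ _ true); split.
  by case=> b [h /compat_id/funext<-].
by exists c; rewrite compat_id.
Qed.

Lemma ord_eq_split T m n (a b : 'I_(m + n) -> T) :
  a =1 b <-> a \o @lshift m n =1 b \o @lshift m n /\
            a \o @rshift m n =1 b \o @rshift m n.
Proof.
split=> [h|[hl hr] i]; first by split=> i /=.
by case: (split_ordP i) => j ->; [exact: hl|exact: hr].
Qed.

Definition ord_glue T m n (a : 'I_m -> T) (b : 'I_n -> T) (i : 'I_(m + n)) :=
  colsum a b (split i).
Lemma ord_gluel T m n (a : 'I_m -> T) (b : 'I_n -> T) :
  ord_glue a b \o @lshift m n =1 a.
Proof. by move=> i; rewrite /= /ord_glue split_lshift. Qed.
Lemma ord_gluer T m n (a : 'I_m -> T) (b : 'I_n -> T) :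
  ord_glue a b \o @rshift m n =1 b.
Proof. by move=> i; rewrite /= /ord_glue split_rshift. Qed.

Lemma corel_tens_id m n :
  corel_tens (corel_id m) (corel_id n) = corel_id (m + n).
Proof.
by apply: compat_inj => a b; rewrite compat_tens !compat_id -ord_eq_split.
Qed.

Lemma corel_tens_comp m n p m' n' p' (f : cor m n) (g : cor n p)
    (f' : cor m' n') (g' : cor n' p') :
  corel_tens (corel_comp f g) (corel_comp f' g')
    = corel_comp (corel_tens f f') (corel_tens g g').
Proof.
apply: compat_inj => a c.
rewrite compat_tens !(compat_comp _ _ true); split.
  case=> [[b [fb gb]] [b' [fb' gb']]]; exists (ord_glue b b').
  by rewrite !compat_tens !(funext (ord_gluel _ _)) !(funext (ord_gluer _ _)).
case=> b [/compat_tens[f1 f2] /compat_tens[g1 g2]].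
by split; [exists (b \o @lshift _ _)|exists (b \o @rshift _ _)].
Qed.

Lemma corel_tensA m n m' n' m'' n''
    (f : cor m n) (g : cor m' n') (h : cor m'' n'') :
  hcast (H := fun m n => cor m n) (addnA m m' m'') (addnA n n' n'')
    (corel_tens f (corel_tens g h)) = corel_tens (corel_tens f g) h.
Proof.
apply: compat_inj => a b; rewrite compat_cast !compat_tens.
have e T p q r (c : _ -> T) : [/\
    c \o cast_ord (addnA p q r) \o @lshift _ _ =1 c \o @lshift _ _ \o @lshift _ _,
    c \o cast_ord (addnA p q r) \o @rshift _ _ \o @lshift _ _
      =1 c \o @lshift _ _ \o @rshift _ _
    & c \o cast_ord (addnA p q r) \o @rshift _ _ \o @rshift _ _ =1 c \o @rshift _ _].
  by split=> i /=; congr c; apply: val_inj; rewrite //= addnA.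
have [/funext-> /funext-> /funext->] := e _ _ _ _ a.
have [/funext-> /funext-> /funext->] := e _ _ _ _ b.
tauto.
Qed.

Lemma corel_tens0f m n (f : cor m n) :
  hcast (H := fun m n => cor m n) (add0n m) (add0n n) (corel_tens (corel_id 0) f) = f.
Proof.
apply: compat_inj => a b; rewrite compat_cast !compat_tens compat_id.
have e T p (c : _ -> T) : c \o cast_ord (add0n p) \o @rshift _ _ =1 c.
  by move=> i /=; congr c; apply: val_inj.
rewrite (funext (e _ _ a)) (funext (e _ _ b)); split=> [[]//|h].
by split=> // -[].
Qed.

Lemma corel_tensf0 m n (f : cor m n) :
  hcast (H := fun m n => cor m n) (addn0 m) (addn0 n) (corel_tens f (corel_id 0)) = f.
Proof.
apply: compat_inj => a b; rewrite compat_cast !compat_tens compat_id.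
have e T p (c : _ -> T) : c \o cast_ord (addn0 p) \o @lshift _ _ =1 c.
  by move=> i /=; congr c; apply: val_inj.
rewrite (funext (e _ _ a)) (funext (e _ _ b)); split=> [[]//|h].
by split=> // -[].
Qed.

Lemma corel_braid_nat m n m' n' (f : cor m n) (g : cor m' n') :
  corel_comp (corel_tens f g) (corel_braid n n')
    = corel_comp (corel_braid m m') (corel_tens g f).
Proof.
apply: compat_inj => a c; rewrite !(compat_comp _ _ true); split.
  case=> b [/compat_tens[hf hg] /compat_braid[/funext e1 /funext e2]].
  exists (ord_glue (a \o @rshift _ _) (a \o @lshift _ _)).
  rewrite compat_tens compat_braid !(funext (ord_gluel _ _)) !(funext (ord_gluer _ _)).
  by rewrite -e1 -e2.
case=> b [/compat_braid[/funext e1 /funext e2] /compat_tens[hg hf]].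
exists (ord_glue (c \o @rshift _ _) (c \o @lshift _ _)).
rewrite compat_tens compat_braid !(funext (ord_gluel _ _)) !(funext (ord_gluer _ _)).
by rewrite e1 e2.
Qed.

Lemma corel_braidK m n :
  corel_comp (corel_braid m n) (corel_braid n m) = corel_id (m + n).
Proof.
apply: compat_inj => a c.
rewrite (compat_comp _ _ true) compat_id ord_eq_split; split.
  case=> b [/compat_braid[/funext e1 /funext e2] /compat_braid[/funext e3 /funext e4]].
  by rewrite e1 e2 e3 e4.
case=> /funext e1 /funext e2.
exists (ord_glue (a \o @rshift _ _) (a \o @lshift _ _)).
by rewrite !compat_braid !(funext (ord_gluel _ _)) !(funext (ord_gluer _ _)) e1 e2.
Qed.

Lemma corel_braid_hex m n p :
  corel_braid m (n + p) = corel_comp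
    (hcast (H := fun m n => cor m n) (esym (addnA m n p)) (esym (addnA n m p))
       (corel_tens (corel_braid m n) (corel_id p)))
    (hcast (H := fun m n => cor m n) (erefl (n + (m + p))) (addnA n p m)
       (corel_tens (corel_id n) (corel_braid m p))).
Proof.
apply: compat_inj => a c; rewrite (compat_comp _ _ true) compat_braid.
pose A1 := a \o @lshift m (n + p).
pose A2 := a \o @rshift m (n + p) \o @lshift n p.
pose A3 := a \o @rshift m (n + p) \o @rshift n p.
pose C1 := c \o @lshift (n + p) m \o @lshift n p.
pose C2 := c \o @lshift (n + p) m \o @rshift n p.
pose C3 := c \o @rshift (n + p) m.
have -> : (a \o @lshift m (n + p) =1 c \o @rshift (n + p) m /\
    a \o @rshift m (n + p) =1 c \o @lshift (n + p) m) <->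
    [/\ A1 =1 C3, A2 =1 C1 & A3 =1 C2].
  by rewrite (ord_eq_split (_ \o @rshift _ _)); split=> [[? []]|[]].
have eb b : compat (hcast (H := fun m n => cor m n) (esym (addnA m n p))
      (esym (addnA n m p)) (corel_tens (corel_braid m n) (corel_id p))) a b <->
    [/\ A1 =1 b \o @rshift _ _ \o @lshift _ _, A2 =1 b \o @lshift _ _
      & A3 =1 b \o @rshift _ _ \o @rshift _ _].
  rewrite compat_cast compat_tens compat_braid compat_id.
  have e T q r s (d : 'I_(q + (r + s)) -> T) : [/\
    d \o cast_ord (esym (addnA q r s)) \o @lshift _ _ \o @lshift _ _ =1 d \o @lshift _ _,
    d \o cast_ord (esym (addnA q r s)) \o @lshift _ _ \o @rshift _ _
      =1 d \o @rshift _ _ \o @lshift _ _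
    & d \o cast_ord (esym (addnA q r s)) \o @rshift _ _
      =1 d \o @rshift _ _ \o @rshift _ _].
    by split=> i /=; congr d; apply: val_inj; rewrite //= addnA.
  have [/funext-> /funext-> /funext->] := e _ _ _ _ a.
  have [/funext-> /funext-> /funext->] := e _ _ _ _ b.
  by split=> [[[]]|[]].
have ec b : compat (hcast (H := fun m n => cor m n) (erefl (n + (m + p)))
      (addnA n p m) (corel_tens (corel_id n) (corel_braid m p))) b c <->
    [/\ b \o @lshift _ _ =1 C1, b \o @rshift _ _ \o @lshift _ _ =1 C3
      & b \o @rshift _ _ \o @rshift _ _ =1 C2].
  rewrite compat_cast compat_tens compat_braid compat_id.
  have [e1 e2 e3] : [/\
    c \o cast_ord (addnA n p m) \o @lshift _ _ =1 C1,
    c \o cast_ord (addnA n p m) \o @rshift _ _ \o @lshift _ _ =1 C2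
    & c \o cast_ord (addnA n p m) \o @rshift _ _ \o @rshift _ _ =1 C3].
    by split=> i /=; congr c; apply: val_inj; rewrite //= addnA.
  rewrite (funext e1) (funext e2) (funext e3).
  have -> : b \o cast_ord (erefl (n + (m + p))) = b.
    by apply/funext=> i /=; rewrite cast_ord_id.
  by split=> [[? []]|[]].
split=> [[/funext h1 /funext h2 /funext h3]|[b []]].
  exists (ord_glue A2 (ord_glue A1 A3)).
  rewrite eb ec !(funext (ord_gluel _ _)) !(funext (ord_gluer _ _)).
  by rewrite !(funext (ord_gluel _ _)) h1 h2 h3.
rewrite eb ec => -[/funext-> /funext-> /funext->] [/funext-> /funext-> /funext->].
by [].
Qed.

End FinCorelLaws.

End FinCorel.

Definition FinCorel : prop := MkProp
  corel_compA corel_comp1f corel_compf1 corel_tens_id corel_tens_comp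
  corel_tensA corel_tens0f corel_tensf0 corel_braid_nat corel_braidK
  corel_braid_hex.
Local Open Scope ring_scope.

Section LinRel.
Variable k : fieldType.
Implicit Types U V W X : vectType k.

Definition lrel U V := {vspace (U * V)%type}.

Definition lrel_graph U V (g : {linear U -> V}) : lrel U V :=
  lker (linfun (fun p : U * V => g p.1 - p.2)).

Definition lrel_comp U V W (R : lrel U V) (S : lrel V W) : lrel U W :=
  (linfun (fun t : U * V * W => (t.1.1, t.2)) @:
    (linfun (fun t : U * V * W => t.1) @^-1: R
     :&: linfun (fun t : U * V * W => (t.1.2, t.2)) @^-1: S))%VS.

Lemma lfunE_lin U V (f : U -> V) : linear f -> forall u, linfun f u = f u.
Proof.
move=> lf u; pose fL := HB.pack_for {linear U -> V} f
  (GRing.isLinear.Build k U V _ f lf).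
exact: (lfunE fL).
Qed.

Lemma mem_lrel_graph U V (g : {linear U -> V}) u v :
  ((u, v) \in lrel_graph g) = (g u == v).
Proof.
rewrite memv_ker lfunE_lin ?subr_eq0 // => a [x y] [x' y'] /=.
by rewrite linearP scalerBr opprD addrACA.
Qed.

Lemma mem_lrel_comp U V W (R : lrel U V) (S : lrel V W) u w :
  (u, w) \in lrel_comp R S <-> exists v, (u, v) \in R /\ (v, w) \in S.
Proof.
have l1 : linear (fun t : U * V * W => (t.1.1, t.2)) by [].
have l2 : linear (fun t : U * V * W => t.1) by [].
have l3 : linear (fun t : U * V * W => (t.1.2, t.2)) by [].
split=> [/memv_imgP[[[x y] z]]|[v [uv vw]]].
  rewrite memv_cap -!memv_preim !lfunE_lin //= => /andP[h1 h2] [-> ->].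
  by exists y.
apply/memv_imgP; exists (u, v, w); rewrite ?lfunE_lin //.
by rewrite memv_cap -!memv_preim !lfunE_lin //= uv.
Qed.

Lemma lrel_eq U V (R S : lrel U V) :
  (forall u v, (u, v) \in R <-> (u, v) \in S) -> R = S.
Proof. by move=> h; apply/vspaceP=> -[u v]; apply/idP/idP => /h. Qed.

(* The object n is k^n = 'rV[k]_n, and k^(m + n) = k^m (+) k^n by
   concatenation of row vectors. *)
Notation rel m n := (lrel 'rV[k]_m 'rV[k]_n).

Definition lrel_id n : rel n n := lrel_graph idfun.

Definition lrel_tens m n m' n' (R : rel m n) (S : rel m' n') :
    rel (m + m') (n + n') :=
  (linfun (fun p : 'rV[k]_(m + m') * 'rV[k]_(n + n') =>
      (lsubmx p.1, lsubmx p.2)) @^-1: R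
   :&: linfun (fun p : 'rV[k]_(m + m') * 'rV[k]_(n + n') =>
      (rsubmx p.1, rsubmx p.2)) @^-1: S)%VS.

Lemma mem_lrel_tens m n m' n' (R : rel m n) (S : rel m' n') u v :
  (u, v) \in lrel_tens R S =
  ((lsubmx u, lsubmx v) \in R) && ((rsubmx u, rsubmx v) \in S).
Proof.
rewrite memv_cap -!memv_preim !lfunE_lin // => a x y /=;
  by rewrite !linearP.
Qed.

Definition swap_row m n (u : 'rV[k]_(m + n)) : 'rV[k]_(n + m) :=
  row_mx (rsubmx u) (lsubmx u).
Fact swap_row_linear m n : linear (@swap_row m n).
Proof.
by move=> a u v; rewrite /swap_row !linearP /= scale_row_mx add_row_mx.
Qed.
HB.instance Definition _ m n :=
  GRing.isLinear.Build k _ _ _ (@swap_row m n) (@swap_row_linear m n).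

Definition lrel_braid m n : rel (m + n) (n + m) := lrel_graph (@swap_row m n).

Definition cast_row m n (e : m = n) (u : 'rV[k]_n) : 'rV[k]_m :=
  castmx (erefl, esym e) u.

Lemma cast_rowE m n (e : m = n) u i : cast_row e u 0 i = u 0 (cast_ord e i).
Proof. by rewrite castmxE cast_ord_id esymK. Qed.

Lemma mem_lrel_cast m n m' n' (em : m = m') (en : n = n') (R : rel m n) u v :
  ((u, v) \in hcast (H := fun m n => rel m n) em en R)
  = ((cast_row em u, cast_row en v) \in R).
Proof.
by case: m' / em u; case: n' / en v => v u; rewrite /cast_row !castmx_id.
Qed.

Lemma row_eq_split m n (u v : 'rV[k]_(m + n)) :
  u = v <-> lsubmx u = lsubmx v /\ rsubmx u = rsubmx v.
Proof.
split=> [->//|[h1 h2]]; by rewrite -[u]hsubmxK -[v]hsubmxK h1 h2.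
Qed.

Lemma lrel_compA m n p q (f : rel m n) (g : rel n p) (h : rel p q) :
  lrel_comp f (lrel_comp g h) = lrel_comp (lrel_comp f g) h.
Proof.
apply: lrel_eq => a d; rewrite !mem_lrel_comp; split.
  case=> b [fb /mem_lrel_comp[c [gc hd]]].
  by exists c; split=> //; rewrite mem_lrel_comp; exists b.
case=> c [/mem_lrel_comp[b [fb gc]] hd].
by exists b; split=> //; rewrite mem_lrel_comp; exists c.
Qed.

Lemma mem_lrel_id n u v : (u, v) \in lrel_id n <-> u = v.
Proof. by rewrite mem_lrel_graph; split=> /eqP. Qed.

Lemma lrel_comp1f m n (f : rel m n) : lrel_comp (lrel_id m) f = f.
Proof.
apply: lrel_eq => a c; rewrite mem_lrel_comp; split.
  by case=> b [/mem_lrel_id->].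
by exists a; rewrite mem_lrel_id.
Qed.

Lemma lrel_compf1 m n (f : rel m n) : lrel_comp f (lrel_id n) = f.
Proof.
apply: lrel_eq => a c; rewrite mem_lrel_comp; split.
  by case=> b [h /mem_lrel_id<-].
by exists c; rewrite mem_lrel_id.
Qed.

Lemma lrel_tens_id m n : lrel_tens (lrel_id m) (lrel_id n) = lrel_id (m + n).
Proof.
apply: lrel_eq => a b; rewrite mem_lrel_tens mem_lrel_id row_eq_split.
by split=> [/andP[/mem_lrel_id-> /mem_lrel_id->]|[h1 h2]] //; apply/andP; rewrite !mem_lrel_id.
Qed.

Lemma lrel_tens_comp m n p m' n' p' (f : rel m n) (g : rel n p)
    (f' : rel m' n') (g' : rel n' p') :
  lrel_tens (lrel_comp f g) (lrel_comp f' g')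
    = lrel_comp (lrel_tens f f') (lrel_tens g g').
Proof.
apply: lrel_eq => a c; rewrite mem_lrel_tens mem_lrel_comp; split.
  case/andP=> /mem_lrel_comp[b [fb gb]] /mem_lrel_comp[b' [fb' gb']].
  exists (row_mx b b').
  by rewrite !mem_lrel_tens !row_mxKl !row_mxKr fb gb fb' gb'.
case=> b [] /[!mem_lrel_tens] /andP[f1 f2] /andP[g1 g2].
by apply/andP; split; apply/mem_lrel_comp; [exists (lsubmx b)|exists (rsubmx b)].
Qed.

Lemma lrel_tensA m n m' n' m'' n''
    (f : rel m n) (g : rel m' n') (h : rel m'' n'') :
  hcast (H := fun m n => rel m n) (addnA m m' m'') (addnA n n' n'')
    (lrel_tens f (lrel_tens g h)) = lrel_tens (lrel_tens f g) h.
Proof.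
apply: lrel_eq => a b; rewrite mem_lrel_cast !mem_lrel_tens.
have e p q r (u : 'rV[k]_(p + q + r)) : [/\
    lsubmx (cast_row (addnA p q r) u) = lsubmx (lsubmx u),
    lsubmx (rsubmx (cast_row (addnA p q r) u)) = rsubmx (lsubmx u)
    & rsubmx (rsubmx (cast_row (addnA p q r) u)) = rsubmx u].
  by split; apply/rowP=> i; rewrite !mxE castmxE /= cast_ord_id; congr (u _ _);
    apply: val_inj; rewrite /= ?addnA.
have [-> -> ->] := e _ _ _ a; have [-> -> ->] := e _ _ _ b.
by rewrite andbA.
Qed.

Lemma lrel_tens0f m n (f : rel m n) :
  hcast (H := fun m n => rel m n) (add0n m) (add0n n)
    (lrel_tens (lrel_id 0) f) = f.
Proof.
apply: lrel_eq => a b; rewrite mem_lrel_cast mem_lrel_tens.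
have e p (u : 'rV[k]_p) : rsubmx (cast_row (add0n p) u) = u.
  by apply/rowP=> i; rewrite !mxE castmxE /= cast_ord_id; congr (u _ _);
    apply: val_inj.
by rewrite !e [lsubmx _]thinmx0 [lsubmx (cast_row _ b)]thinmx0 mem0v.
Qed.

Lemma lrel_tensf0 m n (f : rel m n) :
  hcast (H := fun m n => rel m n) (addn0 m) (addn0 n)
    (lrel_tens f (lrel_id 0)) = f.
Proof.
apply: lrel_eq => a b; rewrite mem_lrel_cast mem_lrel_tens.
have e p (u : 'rV[k]_p) : lsubmx (cast_row (addn0 p) u) = u.
  by apply/rowP=> i; rewrite !mxE castmxE /= cast_ord_id; congr (u _ _);
    apply: val_inj.
by rewrite !e [rsubmx _]thinmx0 [rsubmx (cast_row _ b)]thinmx0 mem0v andbT.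
Qed.

Lemma mem_lrel_braid m n u v : (u, v) \in lrel_braid m n <->
  lsubmx u = rsubmx v /\ rsubmx u = lsubmx v.
Proof.
rewrite mem_lrel_graph /= /swap_row; split=> [/eqP<-|[-> ->]].
  by rewrite row_mxKl row_mxKr.
by rewrite hsubmxK.
Qed.

Lemma lrel_braid_nat m n m' n' (f : rel m n) (g : rel m' n') :
  lrel_comp (lrel_tens f g) (lrel_braid n n')
    = lrel_comp (lrel_braid m m') (lrel_tens g f).
Proof.
apply: lrel_eq => a c; rewrite !mem_lrel_comp; split.
  case=> b [] /[!mem_lrel_tens] /andP[hf hg] /mem_lrel_braid[e1 e2].
  exists (row_mx (rsubmx a) (lsubmx a)).
  by rewrite mem_lrel_tens mem_lrel_braid row_mxKl row_mxKr -e1 -e2 hf hg.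
case=> b [/mem_lrel_braid[e1 e2]] /[!mem_lrel_tens] /andP[hg hf].
exists (row_mx (rsubmx c) (lsubmx c)).
by rewrite mem_lrel_tens mem_lrel_braid row_mxKl row_mxKr e1 e2 hf hg.
Qed.

Lemma lrel_braidK m n :
  lrel_comp (lrel_braid m n) (lrel_braid n m) = lrel_id (m + n).
Proof.
apply: lrel_eq => a c; rewrite mem_lrel_comp mem_lrel_id row_eq_split; split.
  by case=> b [/mem_lrel_braid[-> ->] /mem_lrel_braid[-> ->]].
case=> e1 e2; exists (row_mx (rsubmx a) (lsubmx a)).
by rewrite !mem_lrel_braid row_mxKl row_mxKr e1 e2.
Qed.

Lemma lrel_braid_hex m n p :
  lrel_braid m (n + p) = lrel_comp
    (hcast (H := fun m n => rel m n) (esym (addnA m n p)) (esym (addnA n m p))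
       (lrel_tens (lrel_braid m n) (lrel_id p)))
    (hcast (H := fun m n => rel m n) (erefl (n + (m + p))%N) (addnA n p m)
       (lrel_tens (lrel_id n) (lrel_braid m p))).
Proof.
have e1 q r s (u : 'rV[k]_(q + (r + s))) : [/\
    lsubmx (lsubmx (cast_row (esym (addnA q r s)) u)) = lsubmx u,
    rsubmx (lsubmx (cast_row (esym (addnA q r s)) u)) = lsubmx (rsubmx u)
    & rsubmx (cast_row (esym (addnA q r s)) u) = rsubmx (rsubmx u)].
  by split; apply/rowP=> i; rewrite !mxE castmxE /= cast_ord_id; congr (u _ _);
    apply: val_inj; rewrite /= ?addnA.
have e2 q r s (u : 'rV[k]_(q + r + s)) : [/\
    lsubmx (cast_row (addnA q r s) u) = lsubmx (lsubmx u),
    lsubmx (rsubmx (cast_row (addnA q r s) u)) = rsubmx (lsubmx u)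
    & rsubmx (rsubmx (cast_row (addnA q r s) u)) = rsubmx u].
  by split; apply/rowP=> i; rewrite !mxE castmxE /= cast_ord_id; congr (u _ _);
    apply: val_inj; rewrite /= ?addnA.
have e3 n' (u : 'rV[k]_n') : cast_row (erefl n') u = u by exact: castmx_id.
apply: lrel_eq => a c; rewrite mem_lrel_comp mem_lrel_braid.
have [f1 f2 f3] := e1 _ _ _ a; have [g1 g2 g3] := e2 _ _ _ c; split.
  case=> h1 /row_eq_split[h2 h3].
  exists (row_mx (lsubmx (rsubmx a)) (row_mx (lsubmx a) (rsubmx (rsubmx a)))).
  set b := row_mx _ _; have [b1 b2 b3] := e1 _ _ _ b.
  rewrite !mem_lrel_cast !mem_lrel_tens e3 f3 b3 g1.
  by split; apply/andP; rewrite !(mem_lrel_id, mem_lrel_braid) ?f1 ?f2 ?b1 ?b2 ?g2 ?g3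
    !row_mxKl !row_mxKr ?row_mxKl ?row_mxKr.
case=> b [] /[!mem_lrel_cast] /[!mem_lrel_tens].
have [b1 b2 b3] := e1 _ _ _ b.
rewrite e3 f3 b3 g1 => /andP[/mem_lrel_braid[+ +] /mem_lrel_id+].
rewrite f1 f2 b1 b2 => h1 h2 h3 /andP[/mem_lrel_id+ /mem_lrel_braid[+ +]].
rewrite g2 g3 => h4 h5 h6; split; first by rewrite h1.
by rewrite row_eq_split h2 h4 h3.
Qed.

End LinRel.

Definition FinRel (k : fieldType) : prop := MkProp
  (@lrel_compA k) (@lrel_comp1f k) (@lrel_compf1 k) (@lrel_tens_id k)
  (@lrel_tens_comp k) (@lrel_tensA k) (@lrel_tens0f k) (@lrel_tensf0 k)
  (@lrel_braid_nat k) (@lrel_braidK k) (@lrel_braid_hex k).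

Section Symplectic.
Import VectorInternalTheory.
Variable k : fieldType.
Implicit Types V : vectType k.

Record symplectic V := Symplectic {
  sform :> {biscalar V};
  sform_alt : forall v, sform v v = 0;
  sform_nondeg : forall v, (forall w, sform v w = 0) -> v = 0
}.

Definition isotropic V (w : symplectic V) (L : {vspace V}) : Prop :=
  {in L &, forall u v, w u v = 0}.

Definition lagrangian V (w : symplectic V) (L : {vspace V}) : Prop :=
  isotropic w L /\
  forall L' : {vspace V}, isotropic w L' -> (L <= L')%VS -> L' = L.

Section Conj.
Variables (V : vectType k) (w : symplectic V).
Definition conj_fun (u v : V) : k := - w u v.
Fact conj_bilinear : bilinear_for *%R *%R conj_fun.
Proof.
by split=> [v a u u'|u a v v']; rewrite /conj_fun /= ?linearPl ?linearPr opprD mulrN.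
Qed.
HB.instance Definition _ :=
  bilinear_isBilinear.Build k V V k *%R *%R conj_fun conj_bilinear.
Fact conj_alt v : conj_fun v v = 0.
Proof. by rewrite /conj_fun sform_alt oppr0. Qed.
Fact conj_nondeg v : (forall u, conj_fun v u = 0) -> v = 0.
Proof.
by move=> h; apply: (sform_nondeg (s := w)) => u; apply/eqP; rewrite -oppr_eq0; apply/eqP/h.
Qed.
Definition conj_form : symplectic V := Symplectic conj_alt conj_nondeg.
End Conj.

Section Sum.
Variables (V V' : vectType k) (w : symplectic V) (w' : symplectic V').
Definition sum_fun (p q : V * V') : k := w p.1 q.1 + w' p.2 q.2.
Fact sum_bilinear : bilinear_for *%R *%R sum_fun.
Proof.
by split=> [v a u u'|u a v v']; rewrite /sum_fun /= ?linearPl ?linearPr mulrDr addrACA.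
Qed.
HB.instance Definition _ :=
  bilinear_isBilinear.Build k _ _ k *%R *%R sum_fun sum_bilinear.
Fact sum_alt v : sum_fun v v = 0.
Proof. by rewrite /sum_fun !sform_alt addr0. Qed.
Fact sum_nondeg v : (forall u, sum_fun v u = 0) -> v = 0.
Proof.
case: v => v v' h; congr (_, _).
  by apply: (sform_nondeg (s := w)) => u; have := h (u, 0); rewrite /sum_fun linear0r addr0.
by apply: (sform_nondeg (s := w')) => u; have := h (0, u); rewrite /sum_fun linear0r add0r.
Qed.
Definition sum_form : symplectic (V * V')%type := Symplectic sum_alt sum_nondeg.
End Sum.

Lemma conj_formE V (w : symplectic V) u v : conj_form w u v = - w u v.
Proof. by []. Qed.

Lemma sum_formE V V' (w : symplectic V) (w' : symplectic V') p q :
  sum_form w w' p q = w p.1 q.1 + w' p.2 q.2.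
Proof. by []. Qed.

Definition lagrangian_rel V V' (w : symplectic V) (w' : symplectic V')
    (R : lrel V V') : Prop :=
  lagrangian (sum_form (conj_form w) w') R.

Lemma sformC V (w : symplectic V) u v : w u v = - w v u.
Proof.
have := sform_alt w (u + v).
rewrite linearDr !linearDl /= !sform_alt addr0 add0r => /eqP.
by rewrite addrC addr_eq0 => /eqP.
Qed.

Lemma lagrangianP V (w : symplectic V) (L : {vspace V}) :
  lagrangian w L <-> isotropic w L /\
    forall v, {in L, forall u, w u v = 0} -> v \in L.
Proof.
split=> -[iso h]; split=> //;
  [move=> v vL|move=> L' iso' LL'].
  have vL' : v \in (L + <[v]>)%VS by rewrite memvE addvSr.
  rewrite -(h (L + <[v]>)%VS) ?addvSl // => x y.
  case/memv_addP=> x1 x1L [x2 /vlineP[a ->] ->].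
  case/memv_addP=> y1 y1L [y2 /vlineP[b ->] ->].
  rewrite linearDr !linearDl /= (iso _ _ x1L y1L) !linearZr_LR !linearZl_LR /=.
  by rewrite (vL _ x1L) (sformC w v y1) (vL _ y1L) sform_alt oppr0 !mulr0 !addr0.
apply/eqP; rewrite eqEsubv LL' andbT; apply/subvP=> v vL'.
by apply: h => u uL; apply: iso' => //; apply: (subvP LL').
Qed.

(* Every linear functional is of the form w _ z. *)
Lemma sform_rep V (w : symplectic V) (f : V -> k) :
  scalar f -> exists z, forall u, w u z = f u.
Proof.
move=> lf.
pose n := dim V; pose b (i : 'I_n) : V := @r2v k V (delta_mx 0 i).
pose Om (z : V) : 'rV[k]_n := \row_i w (b i) z.
have lOm : linear Om by move=> a x y; apply/rowP=> i; rewrite !mxE linearPr.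
have ext (g h : V -> k) : scalar g -> scalar h -> (forall i, g (b i) = h (b i)) -> g =1 h.
  move=> lg lh gh u; rewrite -[u]v2rK (row_sum_delta (v2r u)) linear_sum /=.
  have l0 (g' : V -> k) : scalar g' -> g' 0 = 0.
    by move=> lg'; have := lg' (-1) 0 0; rewrite scaler0 addr0 mulN1r addNr.
  elim/big_ind: _ => [|x y gx|i _]; first by rewrite !l0.
    by move=> gy; rewrite -[x]scale1r lg lh gx gy.
  by rewrite linearZ /= -[_ *: _]addr0 lg lh gh !l0.
have inj : lker (linfun Om) == 0%VS.
  apply/eqP/vspaceP => z; rewrite memv_ker lfunE_lin // memv0.
  apply/eqP/eqP => [Oz|->]; last by apply/rowP=> i; rewrite !mxE linear0r.
  apply: (sform_nondeg (s := w)) => u; rewrite sformC; apply/eqP; rewrite oppr_eq0.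
  apply/eqP; apply: (ext (fun u => w u z) (fun _ => 0)).
  - by move=> a x y; rewrite linearPl.
  - by move=> a x y; rewrite mulr0 addr0.
  - by move=> i; have /rowP/(_ i) := Oz; rewrite !mxE.
have /memv_imgP[z _ Hz] : (\row_i f (b i)) \in limg (linfun Om).
  suff -> : limg (linfun Om) = fullv by rewrite memvf.
  apply/eqP; rewrite eqEdim subvf limg_dim_eq ?(eqP inj) ?capv0 //.
  by rewrite !dimvf /dim /= mul1n.
exists z; apply: ext => //; first by move=> a x y; rewrite linearPl.
by move=> i; have /rowP/(_ i) := Hz; rewrite lfunE_lin // !mxE.
Qed.

Lemma sform_sep V (w : symplectic V) (U : {vspace V}) v : v \notin U ->
  exists z, {in U, forall u, w u z = 0} /\ w v z != 0.
Proof.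
move=> vU; pose q u := v2r (u - projv U u).
have q0 : q v != 0.
  rewrite /q; apply: contra vU => /eqP /(congr1 (@r2v k V)); rewrite v2rK linear0 => /eqP.
  by rewrite subr_eq0 => /eqP->; rewrite memv_proj.
have [j qj] : exists j, q v 0 j != 0.
  apply/existsP; apply: contraNT q0; rewrite negb_exists => /forallP h.
  by apply/eqP/rowP=> j; rewrite mxE; apply/eqP; move: (h j); rewrite negbK.
have lq : scalar (fun u => q u 0 j).
  by move=> a x y; rewrite /q linearP /= opprD addrACA -scalerBr linearP /= !mxE.
have [z hz] := sform_rep w lq; exists z; split=> [u uU|]; rewrite hz //.
by rewrite /q projv_id // subrr linear0 mxE.
Qed.

Section Comp.
Variables (U V W : vectType k).
Variables (wU : symplectic U) (wV : symplectic V) (wW : symplectic W).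

Lemma lagrangian_comp (R : lrel U V) (S : lrel V W) :
  lagrangian_rel wU wV R -> lagrangian_rel wV wW S ->
  lagrangian_rel wU wW (lrel_comp R S).
Proof.
move=> /lagrangianP[isoR RP] /lagrangianP[isoS SP]; apply/lagrangianP; split.
  move=> [x z] [x' z'] /mem_lrel_comp[y [h1 h2]] /mem_lrel_comp[y' [h3 h4]].
  have := isoS _ _ h2 h4; have /= := isoR _ _ h1 h3.
  rewrite !(sum_formE, conj_formE) /= => /eqP + /eqP.
  by rewrite ![- _ + _]addrC !subr_eq0 => /eqP<- /eqP->; rewrite subrr.
move=> [x z] hxz.
pose om := sum_form (sum_form (conj_form wU) wV) (sum_form (conj_form wV) wW).
pose D := linfun (fun y : V => (((0, y), (y, 0)) : (U * V) * (V * W))).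
have lD : linear (fun y : V => (((0, y), (y, 0)) : (U * V) * (V * W))).
  by move=> a y y'; rewrite /=; congr (_, _); congr (_, _); rewrite /= scaler0 addr0.
pose P := (linfun (fun p : (U * V) * (V * W) => p.1) @^-1: R
   :&: linfun (fun p : (U * V) * (V * W) => p.2) @^-1: S)%VS.
have memP r s : (r, s) \in P = (r \in R) && (s \in S).
  by rewrite memv_cap -!memv_preim !lfunE_lin.
have [/memv_addP[[[x1 y1] [y2 z2]]]|] :=
  boolP ((((x, 0), (0, z)) : (U * V) * (V * W)) \in (P + limg D)%VS).
  rewrite memP => /andP[h1 h2] [_ /memv_imgP[y _ ->]]; rewrite lfunE_lin //.
  case=> -> e1 e2 ->; rewrite /= !addr0.
  apply/mem_lrel_comp; exists y1; split=> //.
  suff -> : y1 = y2 by [].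
  by apply: (addIr y); rewrite -e1 -e2.
case/(sform_sep om) => -[[p q] [q' r]] [hz /negP[]]; apply/eqP.
have hR : (p, q) \in R.
  apply: RP => u uR; have := hz (u, 0); rewrite /om sum_formE /= linear0l addr0.
  by apply; rewrite memvE (subv_trans _ (addvSl _ _)) // -memvE memP uR mem0v.
have hS : (q', r) \in S.
  apply: SP => u uS; have := hz (0, u); rewrite /om sum_formE /= linear0l add0r.
  by apply; rewrite memvE (subv_trans _ (addvSl _ _)) // -memvE memP uS mem0v.
have e : q = q'.
  apply/eqP; rewrite -subr_eq0; apply/eqP; apply: (sform_nondeg (s := wV)) => y.
  have := hz ((0, y), (y, 0)); rewrite !(sum_formE, conj_formE) /=.
  rewrite !linear0l oppr0 add0r addr0 => hy.
  rewrite sformC linearBr /= hy ?oppr0 //.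
  rewrite memvE (subv_trans _ (addvSr _ _)) // -memvE; apply/memv_imgP.
  by exists y; rewrite ?memvf // lfunE_lin.
have pr : (p, r) \in lrel_comp R S by apply/mem_lrel_comp; exists q; rewrite {2}e.
have := hxz _ pr; rewrite sformC !(sum_formE, conj_formE) /=.
rewrite !linear0l oppr0 addr0 add0r => /eqP; rewrite oppr_eq0 => /eqP; exact.
Qed.

Lemma lagrangian_graph (g : {linear U -> V}) (g' : V -> U) :
  cancel g g' -> cancel g' g -> (forall u u', wV (g u) (g u') = wU u u') ->
  lagrangian_rel wU wV (lrel_graph g).
Proof.
move=> gK g'K gw; apply/lagrangianP; split.
  move=> [u v] [u' v']; rewrite !mem_lrel_graph => /eqP<- /eqP<-.
  by rewrite !(sum_formE, conj_formE) /= gw addNr.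
move=> [u v] h; rewrite mem_lrel_graph -subr_eq0; apply/eqP.
apply: (sform_nondeg (s := wV)) => y; rewrite -[y]g'K sformC linearBr /= gw.
have := h (g' y, g (g' y)); rewrite mem_lrel_graph eqxx !(sum_formE, conj_formE) /=.
by rewrite addrC => /(_ isT) /eqP; rewrite subr_eq0 => /eqP->; rewrite subrr oppr0.
Qed.

End Comp.
End Symplectic.


Section HcastTheory.
Variable D : prop.
Notation cast := (hcast (H := phom D)).

Lemma hcast_id m n (em : m = m) (en : n = n) (f : D m n) : cast em en f = f.
Proof. by rewrite (eq_irrelevance em erefl) (eq_irrelevance en erefl). Qed.

Lemma hcast_trans m m' m'' n n' n'' (em : m = m') (em' : m' = m'')
    (en : n = n') (en' : n' = n'') (f : D m n) :
  cast em' en' (cast em en f) = cast (etrans em em') (etrans en en') f.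
Proof. by case: m'' / em'; case: n'' / en'; rewrite hcast_id. Qed.

Lemma hcast_irr m m' n n' (em em' : m = m') (en en' : n = n') (f : D m n) :
  cast em en f = cast em' en' f.
Proof. by rewrite (eq_irrelevance em em') (eq_irrelevance en en'). Qed.

Lemma hcast_pid n n' (e e' : n = n') : cast e e' (pid D n) = pid D n'.
Proof. by rewrite (eq_irrelevance e' e); case: n' / e {e'}. Qed.

Lemma hcast_pcomp m m' n n' p p' (em : m = m') (en : n = n') (ep : p = p')
    (f : D m n) (g : D n p) :
  cast em ep (pcomp f g) = pcomp (cast em en f) (cast en ep g).
Proof. by case: m' / em; case: n' / en; case: p' / ep. Qed.

Lemma hcast_ptens m m' n n' p p' q q' (em : m = m') (en : n = n')
    (ep : p = p') (eq : q = q') (e : (m + p = m' + p')%N) (e' : (n + q = n' + q')%N)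
    (f : D m n) (g : D p q) :
  ptens (cast em en f) (cast ep eq g) = cast e e' (ptens f g).
Proof.
by move: e e'; case: m' / em; case: n' / en; case: p' / ep; case: q' / eq => e e';
  rewrite !hcast_id.
Qed.

Lemma hcast_pbraid m m' n n' (em : m = m') (en : n = n')
    (e : (m + n = m' + n')%N) (e' : (n + m = n' + m')%N) :
  pbraid D m' n' = cast e e' (pbraid D m n).
Proof. by move: e e'; case: m' / em; case: n' / en => e e'; rewrite hcast_id. Qed.

End HcastTheory.

Section KK.
Variable k : fieldType.

(* The vector (phi_0, I_0, ..., phi_(n-1), I_(n-1)) of (k (+) k)^n is read as
   an element of k^(n * 2). *)
Fact phi_subproof n (i : 'I_n) : (i * 2 < n * 2)%N.
Proof. by rewrite ltn_mul2r ltn_ord. Qed.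
Fact cur_subproof n (i : 'I_n) : (i * 2 + 1 < n * 2)%N.
Proof. by rewrite !muln2 addn1 ltn_Sdouble ltn_ord. Qed.

Definition phi n (v : 'rV[k]_(n * 2)) (i : 'I_n) : k :=
  v 0 (Ordinal (phi_subproof i)).
Definition cur n (v : 'rV[k]_(n * 2)) (i : 'I_n) : k :=
  v 0 (Ordinal (cur_subproof i)).

Definition kk_fun n (u v : 'rV[k]_(n * 2)) : k :=
  \sum_(i < n) (phi u i * cur v i - phi v i * cur u i).

Fact kk_bilinear n : bilinear_for *%R *%R (@kk_fun n).
Proof.
split=> [v a u u'|u a v v']; rewrite /kk_fun /= mulr_sumr -big_split /=;
  apply: eq_bigr => i _; rewrite /phi /cur !mxE.
  by rewrite mulrDl mulrDr opprD addrACA mulrBr -!mulrA [v 0 _ * (a * _)]mulrCA.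
by rewrite mulrDl mulrDr opprD addrACA mulrBr -!mulrA [u 0 _ * (a * _)]mulrCA.
Qed.
HB.instance Definition _ n :=
  bilinear_isBilinear.Build k _ _ k *%R *%R (@kk_fun n) (@kk_bilinear n).

Fact kk_alt n (v : 'rV[k]_(n * 2)) : kk_fun v v = 0.
Proof. by rewrite /kk_fun big1 // => i _; rewrite subrr. Qed.

Lemma kk_ext n (u v : 'rV[k]_(n * 2)) :
  phi u =1 phi v -> cur u =1 cur v -> u = v.
Proof.
move=> hp hc; apply/rowP=> j.
have jn : (j./2 < n)%N.
  by rewrite -ltn_double (leq_ltn_trans _ (leq_trans (ltn_ord j) _)) //
    ?muln2 // -[leqRHS]odd_double_half leq_addl.
have := hp (Ordinal jn); have := hc (Ordinal jn); rewrite /phi /cur.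
have [oj hcj _|oj _ hpj] := boolP (odd j).
  suff e : j = Ordinal (cur_subproof (Ordinal jn)) by rewrite e.
  by apply: val_inj; apply: (etrans (esym (odd_double_half j))); rewrite oj addnC -muln2.
suff e : j = Ordinal (phi_subproof (Ordinal jn)) by rewrite e.
by apply: val_inj; apply: (etrans (esym (odd_double_half j))); rewrite (negPf oj) -muln2.
Qed.

Fact kk_nondeg n (u : 'rV[k]_(n * 2)) : (forall v, kk_fun u v = 0) -> u = 0.
Proof.
move=> h.
have dp i j : phi (delta_mx 0 (Ordinal (phi_subproof i)) : 'rV_(n * 2)) j = (j == i)%:R.
  rewrite /phi mxE eqxx /=; congr (_%:R); congr nat_of_bool.
  by rewrite -val_eqE /= eqn_mul2r.
have dc i j : cur (delta_mx 0 (Ordinal (cur_subproof i)) : 'rV_(n * 2)) j = (j == i)%:R.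
  rewrite /cur mxE eqxx /=; congr (_%:R); congr nat_of_bool.
  by rewrite -val_eqE /= eqn_add2r eqn_mul2r.
have par (i j : 'I_n) : (i * 2 + 1 == j * 2)%N = false.
  by apply/eqP => /(congr1 odd); rewrite !muln2 addn1 /= !odd_double.
have pc i j : phi (delta_mx 0 (Ordinal (cur_subproof i)) : 'rV_(n * 2)) j = 0.
  by rewrite /phi mxE eqxx /= -val_eqE /= eq_sym par.
have cp i j : cur (delta_mx 0 (Ordinal (phi_subproof i)) : 'rV_(n * 2)) j = 0.
  by rewrite /cur mxE eqxx /= -val_eqE /= par.
have z1 i : phi (0 : 'rV_(n * 2)) i = 0 by rewrite /phi mxE.
have z2 i : cur (0 : 'rV_(n * 2)) i = 0 by rewrite /cur mxE.
apply: kk_ext => i; rewrite ?z1 ?z2.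
  have := h (delta_mx 0 (Ordinal (cur_subproof i))).
  rewrite /kk_fun (bigD1 i) //= dc pc eqxx mulr1 mul0r subr0 big1 ?addr0 // => j ji.
  by rewrite dc pc (negPf ji) mulr0 mul0r subrr.
have := h (delta_mx 0 (Ordinal (phi_subproof i))).
rewrite /kk_fun (bigD1 i) //= dp cp eqxx mulr0 mul1r sub0r big1 ?addr0 => [|j ji].
  by move/eqP; rewrite oppr_eq0 => /eqP.
by rewrite dp cp (negPf ji) mulr0 mul0r subrr.
Qed.

Definition kk_form n : symplectic 'rV[k]_(n * 2) :=
  Symplectic (@kk_alt n) (@kk_nondeg n).

Notation ksplit m n u := (cast_row (esym (mulnDl m n 2)) u).

Lemma kk_formD m n (u v : 'rV[k]_((m + n) * 2)) :
  kk_form (m + n) u v = kk_form m (lsubmx (ksplit m n u)) (lsubmx (ksplit m n v))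
    + kk_form n (rsubmx (ksplit m n u)) (rsubmx (ksplit m n v)).
Proof.
have e (x : 'rV[k]_((m + n) * 2)) : [/\
   forall i, phi x (lshift n i) = phi (lsubmx (ksplit m n x)) i,
   forall i, cur x (lshift n i) = cur (lsubmx (ksplit m n x)) i,
   forall i, phi x (rshift m i) = phi (rsubmx (ksplit m n x)) i
   & forall i, cur x (rshift m i) = cur (rsubmx (ksplit m n x)) i].
  by split=> i; rewrite /phi /cur !mxE cast_rowE; congr (x _ _); apply: val_inj;
    rewrite //= mulnDl ?addnA.
have [u1 u2 u3 u4] := e u; have [v1 v2 v3 v4] := e v.
rewrite /= /kk_fun big_split_ord /=; congr (_ + _); apply: eq_bigr => i _.
  by rewrite u1 u2 v1 v2.
by rewrite u3 u4 v3 v4.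
Qed.

Definition lag_hom m n :=
  {R : FinRel k (m * 2)%N (n * 2)%N | lagrangian_rel (kk_form m) (kk_form n) R}.

Definition lag_rel m n (f : lag_hom m n) : FinRel k (m * 2)%N (n * 2)%N := sval f.

Lemma lag_rel_inj m n (f g : lag_hom m n) : lag_rel f = lag_rel g -> f = g.
Proof.
case: f g => f hf [g hg] /= e; case: g / e hg => hg.
by rewrite (Prop_irrelevance hf hg).
Qed.

Definition lag_id n : lag_hom n n :=
  exist _ (pid (FinRel k) (n * 2))
    (lagrangian_graph (g := idfun) (g' := idfun) (fun=> erefl) (fun=> erefl)
       (fun _ _ => erefl)).

Definition lag_comp m n p (f : lag_hom m n) (g : lag_hom n p) : lag_hom m p :=
  exist _ (pcomp (lag_rel f) (lag_rel g)) (lagrangian_comp (svalP f) (svalP g)).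

Definition dbl_tens m n m' n' (f : FinRel k (m * 2)%N (n * 2)%N)
    (g : FinRel k (m' * 2)%N (n' * 2)%N) : FinRel k ((m + m') * 2)%N ((n + n') * 2)%N :=
  hcast (esym (mulnDl m m' 2)) (esym (mulnDl n n' 2)) (ptens f g).

Definition dbl_braid m n : FinRel k ((m + n) * 2)%N ((n + m) * 2)%N :=
  hcast (esym (mulnDl m n 2)) (esym (mulnDl n m 2)) (pbraid (FinRel k) (m * 2) (n * 2)).

Lemma mem_dbl_tens m n m' n' f g u v :
  (u, v) \in @dbl_tens m n m' n' f g =
    ((lsubmx (ksplit _ _ u), lsubmx (ksplit _ _ v)) \in f) &&
    ((rsubmx (ksplit _ _ u), rsubmx (ksplit _ _ v)) \in g).
Proof.
rewrite /dbl_tens /hcast /=. 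
have := mem_lrel_cast (esym (mulnDl m m' 2)) (esym (mulnDl n n' 2)) (lrel_tens f g) u v.
by rewrite mem_lrel_tens => <-.
Qed.

Lemma ksplitK m n (u : 'rV[k]_(m * 2 + n * 2)) : exists x, ksplit m n x = u.
Proof.
exists (cast_row (mulnDl m n 2) u); apply/rowP=> i.
by rewrite !cast_rowE; congr (u _ _); apply: val_inj.
Qed.

Fact dbl_tens_lagrangian m n m' n' f g :
  lagrangian_rel (kk_form m) (kk_form n) f ->
  lagrangian_rel (kk_form m') (kk_form n') g ->
  lagrangian_rel (kk_form (m + m')) (kk_form (n + n')) (dbl_tens f g).
Proof.
move=> /lagrangianP[isof fP] /lagrangianP[isog gP]; apply/lagrangianP; split.
  move=> [u v] [u' v']; rewrite !mem_dbl_tens => /andP[h1 h2] /andP[h3 h4].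
  have := isog _ _ h2 h4; have := isof _ _ h1 h3.
  rewrite !(sum_formE, conj_formE) /= -/(kk_form _ _ _) !kk_formD opprD addrACA.
  by move=> -> ->; rewrite addr0.
move=> [u v] h; rewrite mem_dbl_tens; apply/andP; split.
  apply: fP => -[x y] xy.
  have [x' ex] := ksplitK (row_mx x (0 : 'rV_(m' * 2))).
  have [y' ey] := ksplitK (row_mx y (0 : 'rV_(n' * 2))).
  have := h (x', y'); rewrite mem_dbl_tens !(sum_formE, conj_formE) !kk_formD ex ey.
  rewrite !row_mxKl !row_mxKr mem0v andbT => /(_ xy).
  by rewrite !linear0l !addr0.
apply: gP => -[x y] xy.
have [x' ex] := ksplitK (row_mx (0 : 'rV_(m * 2)) x).
have [y' ey] := ksplitK (row_mx (0 : 'rV_(n * 2)) y).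
have := h (x', y'); rewrite mem_dbl_tens !(sum_formE, conj_formE) !kk_formD ex ey.
rewrite !row_mxKl !row_mxKr mem0v /= => /(_ xy).
by rewrite !linear0l !add0r.
Qed.

Definition dbl_swap m n (u : 'rV[k]_((m + n) * 2)) : 'rV[k]_((n + m) * 2) :=
  cast_row (mulnDl n m 2) (swap_row (ksplit m n u)).

Lemma dbl_swapE m n (u : 'rV[k]_((m + n) * 2)) :
  ksplit n m (dbl_swap u) = row_mx (rsubmx (ksplit m n u)) (lsubmx (ksplit m n u)).
Proof.
apply/rowP=> i; rewrite !cast_rowE /swap_row; congr (row_mx _ _ _ _).
exact: val_inj.
Qed.

Fact dbl_swap_linear m n : linear (@dbl_swap m n).
Proof.
have lc p q (e : p = q) : linear (@cast_row k p q e).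
  by move=> a x y; apply/rowP=> i; rewrite !(mxE, cast_rowE).
by move=> a u v; rewrite /dbl_swap lc linearP lc.
Qed.
HB.instance Definition _ m n :=
  GRing.isLinear.Build k _ _ _ (@dbl_swap m n) (@dbl_swap_linear m n).

Lemma ksplit_inj m n (u v : 'rV[k]_((m + n) * 2)) :
  ksplit m n u = ksplit m n v -> u = v.
Proof.
move=> /rowP h; apply/rowP=> i.
by have := h (cast_ord (mulnDl m n 2) i); rewrite !cast_rowE cast_ordK.
Qed.

Lemma dbl_braid_graph m n : dbl_braid m n = lrel_graph (@dbl_swap m n).
Proof.
apply: lrel_eq => u v.
have := mem_lrel_cast (esym (mulnDl m n 2)) (esym (mulnDl n m 2))
  (lrel_braid k (m * 2) (n * 2)) u v.
rewrite /dbl_braid /= => ->; rewrite mem_lrel_braid mem_lrel_graph.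
split=> [[h1 h2]|/eqP<-].
  apply/eqP/ksplit_inj; rewrite dbl_swapE h1 h2; exact: hsubmxK.
by rewrite dbl_swapE row_mxKl row_mxKr.
Qed.

Fact dbl_braid_lagrangian m n :
  lagrangian_rel (kk_form (m + n)) (kk_form (n + m)) (dbl_braid m n).
Proof.
rewrite dbl_braid_graph; apply: (lagrangian_graph (g' := @dbl_swap n m)).
- move=> u; apply: ksplit_inj; rewrite dbl_swapE dbl_swapE row_mxKl row_mxKr.
  exact: hsubmxK.
- move=> u; apply: ksplit_inj; rewrite dbl_swapE dbl_swapE row_mxKl row_mxKr.
  exact: hsubmxK.
by move=> u v; rewrite !kk_formD !dbl_swapE !row_mxKl !row_mxKr addrC.
Qed.

Definition lag_tens m n m' n' (f : lag_hom m n) (g : lag_hom m' n') :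
    lag_hom (m + m') (n + n') :=
  exist _ (dbl_tens (lag_rel f) (lag_rel g))
    (dbl_tens_lagrangian (svalP f) (svalP g)).

Definition lag_braid m n : lag_hom (m + n) (n + m) :=
  exist _ (dbl_braid m n) (@dbl_braid_lagrangian m n).

Lemma lag_rel_cast m m' n n' (em : m = m') (en : n = n') (f : lag_hom m n) :
  lag_rel (hcast (H := lag_hom) em en f)
    = hcast (H := phom (FinRel k)) (congr1 (muln^~ 2)%N em)
        (congr1 (muln^~ 2)%N en) (lag_rel f).
Proof. by case: m' / em; case: n' / en. Qed.

Notation cast := (hcast (H := phom (FinRel k))).

Lemma lag_relE :
  (forall n, lag_rel (lag_id n) = pid (FinRel k) (n * 2)) *
  (forall m n p (f : lag_hom m n) (g : lag_hom n p),
     lag_rel (lag_comp f g) = pcomp (lag_rel f) (lag_rel g)) *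
  (forall m n m' n' (f : lag_hom m n) (g : lag_hom m' n'),
     lag_rel (lag_tens f g) = dbl_tens (lag_rel f) (lag_rel g)) *
  (forall m n, lag_rel (lag_braid m n) = dbl_braid m n).
Proof. by []. Qed.

Lemma lag_compA m n p q (f : lag_hom m n) (g : lag_hom n p) (h : lag_hom p q) :
  lag_comp f (lag_comp g h) = lag_comp (lag_comp f g) h.
Proof. by apply: lag_rel_inj; apply: lrel_compA. Qed.

Lemma lag_comp1f m n (f : lag_hom m n) : lag_comp (lag_id m) f = f.
Proof. by apply: lag_rel_inj; apply: lrel_comp1f. Qed.

Lemma lag_compf1 m n (f : lag_hom m n) : lag_comp f (lag_id n) = f.
Proof. by apply: lag_rel_inj; apply: lrel_compf1. Qed.

Lemma lag_tens_id m n : lag_tens (lag_id m) (lag_id n) = lag_id (m + n).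
Proof.
apply: lag_rel_inj; rewrite !lag_relE /dbl_tens.
by rewrite [ptens _ _](@ptens_id (FinRel k)); exact: (@hcast_pid (FinRel k)).
Qed.

Lemma lag_tens_comp m n p m' n' p' (f : lag_hom m n) (g : lag_hom n p)
    (f' : lag_hom m' n') (g' : lag_hom n' p') :
  lag_tens (lag_comp f g) (lag_comp f' g')
    = lag_comp (lag_tens f f') (lag_tens g g').
Proof.
apply: lag_rel_inj; rewrite !lag_relE /dbl_tens.
by rewrite [ptens _ _](@ptens_comp (FinRel k)); exact: (@hcast_pcomp (FinRel k)).
Qed.

Lemma lag_tensA m n m' n' m'' n''
    (f : lag_hom m n) (g : lag_hom m' n') (h : lag_hom m'' n'') :
  hcast (H := lag_hom) (addnA m m' m'') (addnA n n' n'')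
    (lag_tens f (lag_tens g h)) = lag_tens (lag_tens f g) h.
Proof.
apply: lag_rel_inj; rewrite lag_rel_cast !lag_relE /dbl_tens.
set F := lag_rel f; set G := lag_rel g; set H := lag_rel h.
have d3 (x y z : nat) : (x * 2 + (y * 2 + z * 2) = x * 2 + (y + z) * 2)%N.
  by rewrite mulnDl.
have d3' (x y z : nat) : (x * 2 + y * 2 + z * 2 = (x + y) * 2 + z * 2)%N.
  by rewrite mulnDl.
rewrite -[F in ptens F (cast _ _ _)](hcast_id erefl erefl).
rewrite (hcast_ptens _ _ _ _ (d3 m m' m'') (d3 n n' n'')).
rewrite -[H in ptens (cast _ _ _) H](hcast_id erefl erefl).
rewrite (hcast_ptens _ _ _ _ (d3' m m' m'') (d3' n n' n'')).
rewrite -(@ptensA (FinRel k)) !hcast_trans; exact: (@hcast_irr (FinRel k)).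
Qed.

Lemma lag_tens0f (m n : nat) (f : lag_hom m n) :
  hcast (H := lag_hom) (add0n m) (add0n n) (lag_tens (lag_id 0) f) = f.
Proof.
apply: lag_rel_inj; rewrite lag_rel_cast !lag_relE /dbl_tens.
rewrite -[RHS](@ptens0f (FinRel k)) !hcast_trans; exact: (@hcast_irr (FinRel k)).
Qed.

Lemma lag_tensf0 (m n : nat) (f : lag_hom m n) :
  hcast (H := lag_hom) (addn0 m) (addn0 n) (lag_tens f (lag_id 0)) = f.
Proof.
apply: lag_rel_inj; rewrite lag_rel_cast !lag_relE /dbl_tens.
rewrite -[RHS](@ptensf0 (FinRel k)) !hcast_trans; exact: (@hcast_irr (FinRel k)).
Qed.

Lemma lag_braid_nat m n m' n' (f : lag_hom m n) (g : lag_hom m' n') :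
  lag_comp (lag_tens f g) (lag_braid n n')
    = lag_comp (lag_braid m m') (lag_tens g f).
Proof.
apply: lag_rel_inj; rewrite !lag_relE /dbl_tens /dbl_braid.
have := @pbraid_nat (FinRel k) _ _ _ _ (lag_rel f) (lag_rel g).
move/(congr1 (cast (esym (mulnDl m m' 2)) (esym (mulnDl n' n 2)))).
rewrite (hcast_pcomp _ (esym (mulnDl n n' 2))) => ->.
exact: (@hcast_pcomp (FinRel k)).
Qed.

Lemma lag_braidK m n : lag_comp (lag_braid m n) (lag_braid n m) = lag_id (m + n).
Proof.
apply: lag_rel_inj; rewrite !lag_relE /dbl_braid.
rewrite -[LHS](hcast_pcomp (D := FinRel k)) (@pbraidK (FinRel k)).
exact: (@hcast_pid (FinRel k)).
Qed.

Lemma lag_braid_hex m n p :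
  lag_braid m (n + p) = lag_comp
    (hcast (H := lag_hom) (esym (addnA m n p)) (esym (addnA n m p))
       (lag_tens (lag_braid m n) (lag_id p)))
    (hcast (H := lag_hom) (erefl (n + (m + p))%N) (addnA n p m)
       (lag_tens (lag_id n) (lag_braid m p))).
Proof.
apply: lag_rel_inj.
rewrite !lag_relE !lag_rel_cast !lag_relE /dbl_tens /dbl_braid.
have e1 : (m * 2 + (n * 2 + p * 2) = m * 2 + (n + p) * 2)%N by rewrite mulnDl.
have e2 : (n * 2 + p * 2 + m * 2 = (n + p) * 2 + m * 2)%N by rewrite mulnDl.
have e3 : (m * 2 + n * 2 + p * 2 = (m + n) * 2 + p * 2)%N by rewrite mulnDl.
have e4 : (n * 2 + m * 2 + p * 2 = (n + m) * 2 + p * 2)%N by rewrite mulnDl.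
have e5 : (n * 2 + (m * 2 + p * 2) = n * 2 + (m + p) * 2)%N by rewrite mulnDl.
have e6 : (n * 2 + (p * 2 + m * 2) = n * 2 + (p + m) * 2)%N by rewrite mulnDl.
have e7 : (n * 2 + (m * 2 + p * 2) = (n + (m + p)) * 2)%N by rewrite !mulnDl.
rewrite (hcast_pbraid (FinRel k) erefl (esym (mulnDl n p 2)) e1 e2).
rewrite (pbraid_hex (FinRel k)) hcast_trans (hcast_pcomp _ e7).
rewrite -[pid (FinRel k) (p * 2)](hcast_id erefl erefl) (hcast_ptens _ _ _ _ e3 e4).
rewrite -[pid (FinRel k) (n * 2)](hcast_id erefl erefl) (hcast_ptens _ _ _ _ e5 e6).
by rewrite !hcast_trans; congr (pcomp _ _); exact: (@hcast_irr (FinRel k)).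
Qed.

End KK.

Definition LagRel (k : fieldType) : prop := MkProp
  (@lag_compA k) (@lag_comp1f k) (@lag_compf1 k) (@lag_tens_id k)
  (@lag_tens_comp k) (@lag_tensA k) (@lag_tens0f k) (@lag_tensf0 k)
  (@lag_braid_nat k) (@lag_braidK k) (@lag_braid_hex k).

Definition related (k : fieldType) m n (R : FinRel k m n)
    (u : 'rV[k]_m) (v : 'rV[k]_n) : bool :=
  (u, v) \in (R : lrel 'rV[k]_m 'rV[k]_n).

(* The values of K on the generators m : 2 -> 1, d : 1 -> 2, i : 0 -> 1 and
   e : 1 -> 0, each of which is the corelation with a single part. *)
Definition generator_values (k : fieldType)
    (K : smfunctor FinCorel (FinRel k) (fun n => n * 2)%N) : Prop :=
  [/\ forall (u : 'rV[k]_(2 * 2)) (v : 'rV[k]_(1 * 2)),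
        related (fhom K (one_part 2 1)) u v <->
        [/\ phi u 0 = phi u 1, phi u 1 = phi v 0
          & cur u 0 + cur u 1 = cur v 0],
      forall (u : 'rV[k]_(1 * 2)) (v : 'rV[k]_(2 * 2)),
        related (fhom K (one_part 1 2)) u v <->
        [/\ phi u 0 = phi v 0, phi v 0 = phi v 1
          & cur u 0 = cur v 0 + cur v 1],
      forall (u : 'rV[k]_(0 * 2)) (v : 'rV[k]_(1 * 2)),
        related (fhom K (one_part 0 1)) u v <-> cur v 0 = 0
    & forall (u : 'rV[k]_(1 * 2)) (v : 'rV[k]_(0 * 2)),
        related (fhom K (one_part 1 0)) u v <-> cur u 0 = 0].

(* A functor with these values on the generators exists: it sends f to the pairs
   of a potential constant on the parts of f and a current whose pairing with
   every such potential vanishes. *)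
Section CircuitFunctor.
Variable k : fieldType.

Lemma vspace_of_closed (V : vectType k) (P : V -> Prop) :
  P 0 -> (forall a u v, P u -> P v -> P (a *: u + v)) ->
  exists U : {vspace V}, forall v, v \in U <-> P v.
Proof.
move=> P0 Plin; pose good d := `[< exists2 U : {vspace V},
  (forall v, v \in U -> P v) & \dim U = d >].
have ex : exists d, good d.
  exists 0%N; apply/asboolP; exists 0%VS; last exact: dimv0.
  by move=> v; rewrite memv0 => /eqP->.
have bd d : good d -> (d <= dim V)%N.
  by move=> /asboolP[U _ <-]; rewrite -dimvf dimvS ?subvf.
case: (ex_maxnP ex bd) => d /asboolP[U UP dU] dmax.
exists U => v; split=> [/UP//|Pv]; have [//|vU] := boolP (v \in U).
have : good (\dim (U + <[v]>)%VS).
  apply/asboolP; exists (U + <[v]>)%VS => // _ /memv_addP[u uU [_ /vlineP[a ->] ->]].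
  by rewrite addrC; apply: Plin => //; exact: UP.
move/dmax; rewrite -dU => le.
have /eqP UE : U == (U + <[v]>)%VS by rewrite eqEdim addvSl.
have : v \in (U + <[v]>)%VS by rewrite memvE addvSr.
by rewrite -UE (negPf vU).
Qed.

Definition circuit m n (f : FinCorel m n)
    (p : 'rV[k]_(m * 2) * 'rV[k]_(n * 2)) : Prop :=
  compat f (phi p.1) (phi p.2) /\
  forall a b, compat f a b ->
    \sum_i a i * cur p.1 i = \sum_j b j * cur p.2 j.

Fact circuit_vspace m n (f : FinCorel m n) :
  {U : lrel 'rV[k]_(m * 2) 'rV[k]_(n * 2) | forall p, p \in U <-> circuit f p}.
Proof.
apply: cid; apply: vspace_of_closed.
  split=> [|a b _]; last by rewrite !big1 // => i _; rewrite /cur mxE mulr0.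
  by move=> [] i [] j _; rewrite /= /phi !mxE.
move=> a [u v] [u' v'] [/= c1 h1] [/= c2 h2]; split=> /=.
  move=> x y xy; have := c1 _ _ xy; have := c2 _ _ xy.
  by case: x {xy} => i; case: y => j; rewrite /= /phi !mxE => -> ->.
move=> c d cd; transitivity (a * (\sum_i c i * cur u i) + \sum_i c i * cur u' i).
  rewrite mulr_sumr -big_split /=; apply: eq_bigr => i _.
  by rewrite /cur !mxE mulrDr mulrCA.
rewrite (h1 _ _ cd) (h2 _ _ cd) mulr_sumr -big_split /=; apply: eq_bigr => i _.
by rewrite /cur !mxE mulrDr mulrCA.
Qed.

Definition circuit_rel m n (f : FinCorel m n) : FinRel k (m * 2)%N (n * 2)%N :=
  sval (circuit_vspace f).

Lemma mem_circuit m n (f : FinCorel m n) u v :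
  (u, v) \in (circuit_rel f : lrel _ _) <-> circuit f (u, v).
Proof. exact: (svalP (circuit_vspace f)). Qed.

Definition kkv n (a b : 'I_n -> k) : 'rV[k]_(n * 2) :=
  \sum_i (a i *: delta_mx 0 (Ordinal (phi_subproof i))
          + b i *: delta_mx 0 (Ordinal (cur_subproof i))).

Lemma phi_kkv n (a b : 'I_n -> k) : phi (kkv a b) =1 a.
Proof.
move=> i; rewrite /phi /kkv summxE (bigD1 i) //= big1 => [|j ji]; rewrite !mxE !eqxx /=.
  rewrite -val_eqE /= (_ : (_ == _) = false) ?mulr0 ?mulr1 ?addr0 //.
  by apply/eqP => /(congr1 odd); rewrite !muln2 addn1 /= !odd_double.
have ij : (i == j :> nat) = false by rewrite val_eqE eq_sym (negPf ji).
rewrite -!val_eqE /= eqn_mul2r /= ij (_ : (_ == _) = false) ?mulr0 ?addr0 //.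
by apply/eqP => /(congr1 odd); rewrite !muln2 addn1 /= !odd_double.
Qed.

Lemma cur_kkv n (a b : 'I_n -> k) : cur (kkv a b) =1 b.
Proof.
move=> i; rewrite /cur /kkv summxE (bigD1 i) //= big1 => [|j ji]; rewrite !mxE !eqxx /=.
  rewrite -val_eqE /= (_ : (_ == _) = false) ?mulr0 ?mulr1 ?addr0 ?add0r //.
  by apply/eqP => /(congr1 odd); rewrite !muln2 addn1 /= !odd_double.
have ij : (i == j :> nat) = false by rewrite val_eqE eq_sym (negPf ji).
rewrite -!val_eqE /= eqn_add2r eqn_mul2r /= ij
  (_ : (_ == _) = false) ?mulr0 ?addr0 //.
by apply/eqP => /(congr1 odd); rewrite !muln2 addn1 /= !odd_double.
Qed.

Lemma kk_formE n (u v : 'rV[k]_(n * 2)) :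
  kk_form k n u v = \sum_i phi u i * cur v i - \sum_i phi v i * cur u i.
Proof. by rewrite /= /kk_fun sumrB. Qed.

Lemma circuit_lagrangian m n (f : FinCorel m n) :
  lagrangian_rel (kk_form k m) (kk_form k n) (circuit_rel f).
Proof.
apply/lagrangianP; split=> [[u v] [u' v'] /mem_circuit[/= c h] /mem_circuit[/= c' h']|].
  rewrite sum_formE conj_formE /= -!/(kk_form _ _ _ _) !kk_formE.
  by rewrite (h' _ _ c) (h _ _ c') addNr.
move=> [u v] hv; apply/mem_circuit; split=> /= [x y xy|a b ab].
  pose d (z : 'I_m + 'I_n) (t : 'I_m + 'I_n) : k := (t == z)%:R.
  pose sg (t : 'I_m + 'I_n) : k := if t is inl _ then 1 else -1.
  pose cu t := sg t * (d x t - d y t).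
  have sumz (w : 'I_m + 'I_n -> k) :
    \sum_i w (inl i) * cu (inl i) - \sum_j w (inr j) * cu (inr j) = w x - w y.
    transitivity (\sum_t w t * (d x t - d y t)).
      rewrite [RHS]big_sumType /= -sumrN; congr (_ + _); apply: eq_bigr => i _.
        by rewrite /cu mul1r.
      by rewrite /cu mulN1r mulrN opprK.
    have dl z : \sum_t w t * d z t = w z.
      by rewrite (bigD1 z) //= /d eqxx mulr1 big1 ?addr0 // => t /negPf->; rewrite mulr0.
    by rewrite -[in RHS](dl x) -[in RHS](dl y) -sumrB; apply: eq_bigr => t _; rewrite mulrBr.
  have /mem_circuit/hv : circuit f (kkv (fun _ => 0) (cu \o inl), kkv (fun _ => 0) (cu \o inr)).
    split=> /= [z t _|a b ab].
      by case: z t => i [] j; rewrite /= !phi_kkv.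
    under eq_bigr do rewrite cur_kkv; under [RHS]eq_bigr do rewrite cur_kkv.
    have := sumz (colsum a b); rewrite /= (ab _ _ xy) subrr => /eqP.
    by rewrite subr_eq0 => /eqP.
  rewrite sum_formE conj_formE /= -!/(kk_form _ _ _ _) !kk_formE.
  rewrite [X in - (X - _)]big1 => [|i _]; last by rewrite phi_kkv mul0r.
  rewrite [X in _ + (X - _)]big1 => [|i _]; last by rewrite phi_kkv mul0r.
  under eq_bigr do rewrite cur_kkv; under [X in _ + (_ - X)]eq_bigr do rewrite cur_kkv.
  have := sumz (colsum (phi u) (phi v)); rewrite /= !sub0r opprK => ->.
  by move/eqP; rewrite subr_eq0 => /eqP.
have /mem_circuit/hv : circuit f (kkv a (fun _ => 0), kkv b (fun _ => 0)).
  split=> /= [|c d _].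
    by apply/(eq_compat f (phi_kkv _ _) (phi_kkv _ _)).
  by rewrite !big1 // => i _; rewrite cur_kkv mulr0.
rewrite sum_formE conj_formE /= -!/(kk_form _ _ _ _) !kk_formE.
rewrite [X in - (_ - X)]big1 => [|i _]; last by rewrite cur_kkv mulr0.
rewrite [X in _ + (_ - X)]big1 => [|i _]; last by rewrite cur_kkv mulr0.
under [X in - (X - _)]eq_bigr do rewrite phi_kkv.
under [X in _ + (X - _)]eq_bigr do rewrite phi_kkv.
by rewrite !subr0 addrC => /eqP; rewrite subr_eq0 => /eqP.
Qed.

Lemma lagrangian_sub_eq (V : vectType k) (w : symplectic V) (L L' : {vspace V}) :
  lagrangian w L -> lagrangian w L' -> (forall v, v \in L -> v \in L') -> L = L'.
Proof.
move=> [_ h] [iso' _] LL'; symmetry; apply: h => //; exact/subvP.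
Qed.

Lemma circuit_id n : circuit_rel (corel_id n) = pid (FinRel k) (n * 2).
Proof.
symmetry; apply: (lagrangian_sub_eq (svalP (lag_id k n)) (circuit_lagrangian _)).
move=> [u v] /mem_lrel_id <-; apply/mem_circuit; split=> /=; first exact/compat_id.
by move=> a b /compat_id/funext->.
Qed.

Lemma circuit_comp m n p (f : FinCorel m n) (g : FinCorel n p) :
  circuit_rel (corel_comp f g) = lrel_comp (circuit_rel f) (circuit_rel g).
Proof.
symmetry; apply: (lagrangian_sub_eq
  (lagrangian_comp (circuit_lagrangian f) (circuit_lagrangian g))
  (circuit_lagrangian _)).
move=> [u w] /mem_lrel_comp[v [/mem_circuit[/= c h] /mem_circuit[/= c' h']]].
apply/mem_circuit; split=> /=; first by apply/(compat_comp _ _ 0); exists (phi v).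
by move=> a b /(compat_comp _ _ 0)[d [ad db]]; rewrite (h _ _ ad) (h' _ _ db).
Qed.

Lemma ksplit_phi m n (u : 'rV[k]_((m + n) * 2)) :
  let u' := cast_row (esym (mulnDl m n 2)) u in
  [/\ phi u \o @lshift m n =1 phi (lsubmx u'), cur u \o @lshift m n =1 cur (lsubmx u'),
      phi u \o @rshift m n =1 phi (rsubmx u') & cur u \o @rshift m n =1 cur (rsubmx u')].
Proof.
by split=> i; rewrite /phi /cur !mxE cast_rowE; congr (u _ _); apply: val_inj;
  rewrite //= mulnDl ?addnA.
Qed.

Lemma circuit_tens m n m' n' (f : FinCorel m n) (g : FinCorel m' n') :
  circuit_rel (corel_tens f g) = dbl_tens (circuit_rel f) (circuit_rel g).
Proof.
symmetry; apply: (lagrangian_sub_eq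
  (dbl_tens_lagrangian (circuit_lagrangian f) (circuit_lagrangian g))
  (circuit_lagrangian _)).
move=> [u v]; rewrite mem_dbl_tens => /andP[/mem_circuit[/= c h] /mem_circuit[/= c' h']].
have [u1 u2 u3 u4] := ksplit_phi u; have [v1 v2 v3 v4] := ksplit_phi v.
apply/mem_circuit; split=> /= [|a b /compat_tens[h1 h2]].
  by apply/compat_tens; rewrite (funext u1) (funext v1) (funext u3) (funext v3).
rewrite !big_split_ord /=; congr (_ + _).
  under eq_bigr do rewrite -[cur u _]/((cur u \o _) _) u2.
  under [RHS]eq_bigr do rewrite -[cur v _]/((cur v \o _) _) v2.
  exact: (h _ _ h1).
under eq_bigr do rewrite -[cur u _]/((cur u \o _) _) u4.
under [RHS]eq_bigr do rewrite -[cur v _]/((cur v \o _) _) v4.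
exact: (h' _ _ h2).
Qed.

Lemma circuit_braid m n : circuit_rel (corel_braid m n) = dbl_braid k m n.
Proof.
symmetry; apply: (lagrangian_sub_eq (dbl_braid_lagrangian k m n) (circuit_lagrangian _)).
move=> [u v]; rewrite dbl_braid_graph mem_lrel_graph => /eqP<-.
have [u1 u2 u3 u4] := ksplit_phi u.
have := ksplit_phi (dbl_swap u); rewrite /= dbl_swapE row_mxKl row_mxKr => -[v1 v2 v3 v4].
apply/mem_circuit; split=> /= [|a b /compat_braid[h1 h2]].
  by apply/compat_braid; rewrite (funext u1) (funext v1) (funext u3) (funext v3).
rewrite !big_split_ord /= addrC; congr (_ + _); apply: eq_bigr => i _.
  by rewrite -[a _]/((a \o _) _) h2; congr (_ * _); have := u4 i; have := v2 i; rewrite /= => -> ->.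
by rewrite -[a _]/((a \o _) _) h1; congr (_ * _); have := u2 i; have := v4 i; rewrite /= => -> ->.
Qed.

Fact dblD m n : ((m + n) * 2 = m * 2 + n * 2)%N. Proof. exact: mulnDl. Qed.

Definition circuit_functor : smfunctor FinCorel (FinRel k) (fun n => n * 2)%N.
Proof.
refine (@MkFunctor FinCorel (FinRel k) (fun n => n * 2)%N circuit_rel (mul0n 2) dblD
  circuit_id circuit_comp _ _).
- move=> m n m' n' f g; rewrite circuit_tens /dbl_tens.
  by rewrite [LHS](@hcast_trans (FinRel k)) (hcast_id (D := FinRel k)).
move=> m n; rewrite circuit_braid /dbl_braid.
by rewrite [LHS](@hcast_trans (FinRel k)) (hcast_id (D := FinRel k)).
Defined.

Lemma circuit_one_part m n (u : 'rV[k]_(m * 2)) (v : 'rV[k]_(n * 2)) :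
  related (circuit_rel (one_part m n)) u v <->
  (forall x y, colsum (phi u) (phi v) x = colsum (phi u) (phi v) y) /\
  \sum_i cur u i = \sum_j cur v j.
Proof.
split=> [/mem_circuit[/= c h]|[c h]].
  split=> [x y|]; first by apply: c; rewrite same_kernel.
  have /h : compat (one_part m n) (fun _ => 1 : k) (fun _ => 1) by move=> [] i [] j.
  by under eq_bigr do rewrite mul1r; under [RHS]eq_bigr do rewrite mul1r.
apply/mem_circuit; split=> /= [x y _|a b /compat_kernel ab]; first exact: c.
have [c0 ac bc] : exists2 c0, (forall i, a i = c0) & (forall j, b j = c0).
  have [[z _]|no] := pselect (exists z : 'I_m + 'I_n, True).
    by exists (colsum a b z) => i; [apply: (ab (inl i))|apply: (ab (inr i))].
  by exists 0 => i; case: no; [exists (inl i)|exists (inr i)].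
under eq_bigr do rewrite ac; under [RHS]eq_bigr do rewrite bc.
by rewrite -!mulr_sumr h.
Qed.

Lemma circuit_generator_values : generator_values circuit_functor.
Proof.
have o1 (x : 'I_1) : x = 0 by rewrite ord1.
have o2 (x : 'I_2) : x = 0 \/ x = 1.
  by case: x => [[|[|//]] hx]; [left|right]; apply: val_inj.
split=> u v; (apply: iff_trans; first exact: circuit_one_part);
  rewrite ?big_ord_recl ?big_ord0 ?addr0; split.
- case=> c e; split.
  + exact: (c (inl 0) (inl 1)).
  + exact: (c (inl 1) (inr 0)).
  + by rewrite -[RHS]e; congr (_ + cur u _); apply: val_inj.
- case=> h1 h2 e; split; last first.
    by rewrite -[RHS]e; congr (_ + cur u _); apply: val_inj.
  have cE x : colsum (phi u) (phi v) x = phi v 0.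
    by case: x => i /=; [case: (o2 i) => ->; rewrite ?h1 ?h2|rewrite (o1 i)].
  by move=> x y; rewrite !cE.
- case=> c e; split.
  + exact: (c (inl 0) (inr 0)).
  + exact: (c (inr 0) (inr 1)).
  + by rewrite [LHS]e; congr (_ + cur v _); apply: val_inj.
- case=> h1 h2 e; split; last first.
    by rewrite [LHS]e; congr (_ + cur v _); apply: val_inj.
  have cE x : colsum (phi u) (phi v) x = phi v 0.
    by case: x => i /=; [rewrite (o1 i)|case: (o2 i) => ->; rewrite -?h2].
  by move=> x y; rewrite !cE.
- by case=> _ /esym.
- move=> e; split; last by rewrite e.
  by move=> [[]//|x] [[]//|y]; rewrite (o1 x) (o1 y).
- by case.
- move=> e; split; last by rewrite e.
  by move=> [x|[]//] [y|[]//]; rewrite (o1 x) (o1 y).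
Qed.

End CircuitFunctor.

(* Main.v *)
Require Import Defs.
From mathcomp Require Import all_boot all_order all_algebra.
From mathcomp Require Import boolp.

Set Implicit Arguments.
Unset Strict Implicit.
Unset Printing Implicit Defensive.

(** Being Lagrangian is stable under composition, direct sum, identities and
    braidings, so for any functor [K] with these objects the morphisms sent to
    Lagrangian relations form a sub-prop of FinCorel.  It contains the four
    generators: their prescribed values are those of the circuit functor, which
    takes Lagrangian values everywhere.  The proof therefore rests on the fact
    that the generators exhaust FinCorel ([corel_generated]).

    A corelation is the composite of the graph of a function with the converse
    of the graph of another ([corel_factor]): send each point to a chosen
    representative of its part.  As the generators are stable under taking
    converses, only graphs of functions are left, and these come from the
    commutative monoid structure: adding a point to the domain of a function
    composes its graph with a fold map [[x, id] : 1 + p -> p], which moves the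
    new point by transpositions until it can be multiplied into [x]. *)

(** * Sub-props *)

Record subprop (C : prop) (P : forall m n, C m n -> Prop) : Prop := Subprop {
  subprop_id : forall n, P _ _ (pid C n);
  subprop_comp : forall m n p (f : C m n) (g : C n p),
    P _ _ f -> P _ _ g -> P _ _ (Defs.pcomp f g);
  subprop_tens : forall m n m' n' (f : C m n) (g : C m' n'),
    P _ _ f -> P _ _ g -> P _ _ (ptens f g);
  subprop_braid : forall m n, P _ _ (pbraid C m n)
}.

(** * The converse of a corelation *)

Definition sum_swap A B (x : A + B) : B + A :=
  match x with inl a => inr a | inr b => inl b end.

Section Mirror.
Variables A B : finType.

Definition corel_mirror (f : corel A B) : corel B A :=
  @corel_of B A [rel x y | same_part f (sum_swap x) (sum_swap y)]
    (fun x y z => same_equiv f (sum_swap x) (sum_swap y) (sum_swap z)).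

Lemma compat_mirror T (f : corel A B) (a : A -> T) (b : B -> T) :
  compat (corel_mirror f) b a <-> compat f a b.
Proof.
have colE x : colsum b a (sum_swap x) = colsum a b x by case: x.
have swapK x : sum_swap (sum_swap x) = x :> A + B by case: x.
split=> h x y xy; last first.
  by move: xy; rewrite same_corel_of /= => /h; case: x => x; case: y.
by rewrite -!colE; apply: h; rewrite same_corel_of /= !swapK.
Qed.

End Mirror.

Lemma mirror_comp (A B C : finType) (f : corel A B) (g : corel B C) :
  corel_mirror (corel_comp f g) = corel_comp (corel_mirror g) (corel_mirror f).
Proof.
apply: compat_inj => c a; rewrite compat_mirror !(compat_comp _ _ true).
by split=> -[b [hf hg]]; exists b; move: hf hg; rewrite !compat_mirror.
Qed.

Lemma mirror_id n : corel_mirror (corel_id n) = corel_id n.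
Proof.
by apply: compat_inj => a b; rewrite compat_mirror !compat_id; split=> h i.
Qed.

Lemma mirror_tens m n m' n' (f : corel 'I_m 'I_n) (g : corel 'I_m' 'I_n') :
  corel_mirror (corel_tens f g)
    = corel_tens (corel_mirror f) (corel_mirror g).
Proof.
by apply: compat_inj => a b; rewrite compat_mirror !compat_tens !compat_mirror.
Qed.

Lemma mirror_braid m n : corel_mirror (corel_braid m n) = corel_braid n m.
Proof.
apply: compat_inj => a b; rewrite compat_mirror !compat_braid.
by split=> -[h1 h2]; split=> i; rewrite ?h1 ?h2.
Qed.

Lemma mirror_one_part m n : corel_mirror (one_part m n) = one_part n m.
Proof. by apply: corel_same_inj => x y; rewrite same_corel_of /= !same_kernel. Qed.

Lemma subprop_mirror (P : forall m n, FinCorel m n -> Prop) :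
  subprop P -> subprop (C := FinCorel) (fun m n f => P n m (corel_mirror f)).
Proof.
move=> sP; split=> [n|m n p f g Pf Pg|m n m' n' f g Pf Pg|m n] /=.
- by rewrite mirror_id; exact: (subprop_id sP n).
- by rewrite mirror_comp; exact: (subprop_comp sP Pg Pf).
- by rewrite mirror_tens; exact: (subprop_tens sP Pf Pg).
- by rewrite mirror_braid; exact: (subprop_braid sP n m).
Qed.

(** * Graphs of functions *)

Definition corel_graph m n (c : 'I_m -> 'I_n) : FinCorel m n :=
  corel_kernel (fun x => match x with inl i => c i | inr j => j end).

Lemma compat_graph T m n (c : 'I_m -> 'I_n) (a : 'I_m -> T) (b : 'I_n -> T) :
  compat (corel_graph c) a b <-> a =1 b \o c.
Proof.
rewrite compat_kernel; split=> [h i|h]; first exact: (h (inl i) (inr (c i))).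
have e x : colsum a b x = b (match x with inl i => c i | inr j => j end).
  by case: x => // i; exact: h.
by move=> x y; rewrite !e => ->.
Qed.

(** The cospan through [m + n] points, most of which represent no part: the
    isolated middle points leave no trace in the composite, so the parts need
    not be counted. *)
Lemma corel_factor m n (f : FinCorel m n) :
  exists c d, f = corel_comp (@corel_graph m (m + n) c)
                    (corel_mirror (@corel_graph n (m + n) d)).
Proof.
pose rep x := odflt x [pick y | same_part f x y].
have repP x : same_part f x (rep x).
  by rewrite /rep; case: pickP => //= _; exact: same_refl.
have repE x y : same_part f x y -> rep x = rep y.
  move=> xy; have /eq_pick e : same_part f x =1 same_part f y.
    by move=> z; case: (same_equiv f x y z) => _ ->.
  rewrite /rep -e; case: pickP => // /(_ x).
  by rewrite same_refl.
exists (fun i => unsplit (rep (inl i))), (fun j => unsplit (rep (inr j))).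
apply: compat_inj => a b; rewrite (compat_comp _ _ true).
split=> [h|[g [/compat_graph ga]]].
  have e x : colsum a b x = ord_glue a b (unsplit (rep x)).
    by rewrite /ord_glue unsplitK; exact: h.
  exists (ord_glue a b); rewrite compat_mirror !compat_graph.
  by split=> i; [exact: (e (inl i))|exact: (e (inr i))].
rewrite compat_mirror compat_graph => gb x y /repE xy.
have e z : colsum a b z = g (unsplit (rep z)).
  by case: z => i; [exact: ga|exact: gb].
by rewrite !e xy.
Qed.

(** * Generation by the one-part corelations *)

(** The fold map [[x, id] : 1 + p -> p]. *)
Definition fold_map p (x : 'I_p) (i : 'I_(1 + p)) : 'I_p :=
  colsum (fun=> x) id (split i).

Lemma compat_fold T p (x : 'I_p) (a : 'I_(1 + p) -> T) (b : 'I_p -> T) :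
  compat (corel_graph (fold_map x)) a b <->
  a (lshift p ord0) = b x /\ a \o @rshift 1 p =1 b.
Proof.
rewrite compat_graph (@ord_eq_split T 1 p); split=> -[h1 h2]; split.
- by have := h1 ord0; rewrite /= /fold_map split_lshift.
- by move=> i; rewrite h2 /= /fold_map split_rshift.
- by move=> i; rewrite /= /fold_map split_lshift ord1 h1.
- by move=> i; rewrite /= /fold_map split_rshift; exact: h2.
Qed.

Lemma compat_mult T (a : 'I_2 -> T) (b : 'I_1 -> T) :
  compat (one_part 2 1) a b <-> a ord0 = b ord0 /\ a (@rshift 1 1 ord0) = b ord0.
Proof.
rewrite compat_kernel; split=> [h|[h0 h1]].
  by split; [exact: (h (inl _) (inr _))|exact: (h (inl _) (inr _))].
have e x : colsum a b x = b ord0.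
  case: x => i /=; last by rewrite ord1.
  by case: (@split_ordP 1 1 i) => j ->; rewrite (ord1 j) // -h0; congr a; exact: val_inj.
by move=> x y _; rewrite !e.
Qed.

Section FunctionsGenerated.
Variables (P : forall m n, FinCorel m n -> Prop) (sP : subprop P).
Hypotheses (Pmult : P (one_part 2 1)) (Punit : P (one_part 0 1)).

(** If [x] is the first point, multiply the new point into it; otherwise move the
    new point past the first one by a transposition and recurse on the rest. *)
Lemma subprop_fold p (x : 'I_p) : P (corel_graph (fold_map x)).
Proof.
elim: p x => [[]//|p IHp] x.
(* The points of 2 + p, bracketed as 1 + (1 + p) and as (1 + 1) + p. *)
pose q0 : 'I_(2 + p) := @lshift 1 (1 + p) ord0.
pose q1 : 'I_(2 + p) := @rshift 1 (1 + p) (@lshift 1 p ord0).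
pose q2 j : 'I_(2 + p) := @rshift 1 (1 + p) (@rshift 1 p j).
have pt0 : @lshift 2 p (@lshift 1 1 ord0) = q0 by exact: val_inj.
have pt1 : @lshift 2 p (@rshift 1 1 ord0) = q1 by exact: val_inj.
have pt2 j : @rshift 2 p j = q2 j by exact: val_inj.
case: (@split_ordP 1 p x) => y ->.
  suff -> : corel_graph (fold_map (lshift p y))
      = corel_tens (one_part 2 1) (corel_id p) :> FinCorel (2 + p) (1 + p).
    exact: (subprop_tens sP Pmult (subprop_id sP p)).
  apply: compat_inj => a b; rewrite (ord1 y).
  rewrite compat_tens compat_mult compat_id compat_fold (@ord_eq_split _ 1 p).
  rewrite /= pt1; split=> [[h0 [h1 h2]]|[[h0 h1] h2]].
    split=> [|j]; last by rewrite /= pt2; exact: h2.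
    by split; [rewrite -h0; congr a; exact: val_inj|exact: (h1 ord0)].
  split; first by rewrite -h0; congr a; exact: val_inj.
  split=> j /=; last by rewrite -[a _]/(a (q2 j)) -pt2; exact: h2.
  by rewrite (ord1 j).
suff -> : corel_graph (fold_map (rshift 1 y))
    = corel_comp (corel_tens (corel_braid 1 1) (corel_id p))
                 (corel_tens (corel_id 1) (corel_graph (fold_map y)))
    :> FinCorel (2 + p) (1 + p).
  apply: (subprop_comp sP).
    exact: (subprop_tens sP (subprop_braid sP 1 1) (subprop_id sP p)).
  exact: (subprop_tens sP (subprop_id sP 1) (IHp y)).
have swapE (a d : 'I_(2 + p) -> bool) :
    compat (corel_tens (corel_braid 1 1) (corel_id p)) a d <->
    [/\ a q0 = d q1, a q1 = d q0 & forall j, a (q2 j) = d (q2 j)].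
  rewrite compat_tens compat_braid compat_id.
  split=> [[[h0 h1] h2]|[h0 h1 h2]].
    split; [move: (h0 ord0)|move: (h1 ord0)|move=> j; move: (h2 j)];
      by rewrite /= ?pt0 ?pt1 ?pt2.
  by split; [split|] => j /=; rewrite ?(ord1 j) ?pt0 ?pt1 ?pt2.
apply: compat_inj => a b; rewrite (compat_comp _ _ true) compat_fold.
rewrite (@ord_eq_split _ 1 p); split=> [[h0 [h1 h2]]|[d [/swapE[h0 h1 h2]]]].
  pose d := @ord_glue _ 1 (1 + p) (fun=> a q1)
    (@ord_glue _ 1 p (fun=> a q0) (a \o q2)).
  have dq0 : d q0 = a q1 by rewrite /d /ord_glue split_lshift.
  have dq1 : d q1 = a q0.
    by rewrite /d /ord_glue split_rshift /= split_lshift.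
  have dq2 j : d (q2 j) = a (q2 j).
    by rewrite /d /ord_glue split_rshift /= split_rshift.
  exists d; rewrite swapE (@compat_tens 1 1 (1 + p) p) compat_id compat_fold.
  split; first by split.
  split=> [j|]; first by rewrite (ord1 j) [LHS]dq0; exact: (h1 ord0).
  by split=> [|j]; [rewrite [LHS]dq1; exact: h0|rewrite [LHS]dq2; exact: h2].
rewrite (@compat_tens 1 1 (1 + p) p) compat_id compat_fold => -[d0 [d1 d2]].
split; first exact: etrans h0 d1.
split=> j; last exact: etrans (h2 j) (d2 j).
by rewrite (ord1 j); exact: etrans h1 (d0 ord0).
Qed.

(** Induction on the domain, one fold map per point; the empty function into [n]
    points is a direct sum of units. *)
Lemma subprop_graph m n (c : 'I_m -> 'I_n) : P (corel_graph c).
Proof.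
elim: m c => [|m IHm] c.
  elim: n c => [|n IHn] c.
    suff -> : corel_graph c = corel_id 0 by exact: (subprop_id sP 0).
    apply: compat_inj => a b; rewrite compat_graph compat_id.
    by split=> _ [].
  have c' : 'I_0 -> 'I_n by case.
  suff -> : corel_graph c = corel_tens (one_part 0 1) (corel_graph c')
      :> FinCorel (0 + 0) (1 + n).
    exact: (subprop_tens sP Punit (IHn c')).
  apply: compat_inj => a b; rewrite compat_tens !compat_graph.
  split=> [_|_ []//]; split; last by case.
  by rewrite compat_kernel => -[[]//|x] [[]//|y] _; rewrite (ord1 x) (ord1 y).
suff -> : corel_graph c = corel_comp
    (corel_tens (corel_id 1) (corel_graph (c \o @rshift 1 m)))
    (corel_graph (fold_map (c (@lshift 1 m ord0)))) :> FinCorel (1 + m) n.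
  apply: (subprop_comp sP); last exact: subprop_fold.
  exact: (subprop_tens sP (subprop_id sP 1) (IHm _)).
apply: compat_inj => a b; rewrite (compat_comp _ _ true) compat_graph.
rewrite (@ord_eq_split _ 1 m); split=> [[h0 h1]|[d []]].
  exists (ord_glue (a \o @lshift 1 m) b).
  rewrite compat_tens compat_id compat_graph compat_fold.
  rewrite !(funext (ord_gluel _ _)) !(funext (ord_gluer _ _)).
  split; split=> //.
  by rewrite -[LHS]/((ord_glue _ _ \o @lshift 1 n) ord0) ord_gluel; exact: h0.
rewrite compat_tens compat_id compat_graph compat_fold.
move=> [d0 d1] [e0 e1]; split=> i /=.
  by rewrite [a _]d0 (ord1 i).
by rewrite [a _]d1 /= [d _]e1.
Qed.

End FunctionsGenerated.

(** The corelations whose converse lies in [P] form a sub-prop too; it contains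
    the monoid [(2 -> 1, 0 -> 1)] because [P] contains its converse, the comonoid
    [(1 -> 2, 1 -> 0)].  Hence it contains all graphs, and [P] contains both
    factors of any corelation. *)
Theorem corel_generated (P : forall m n, FinCorel m n -> Prop) :
  subprop P ->
  P _ _ (one_part 2 1) -> P _ _ (one_part 1 2) ->
  P _ _ (one_part 0 1) -> P _ _ (one_part 1 0) ->
  forall m n (f : FinCorel m n), P _ _ f.
Proof.
move=> sP Pm Pd Pi Pe m n f; have [c [d ->]] := corel_factor f.
apply: (subprop_comp sP); first exact: subprop_graph.
apply: (subprop_graph (subprop_mirror sP)); rewrite mirror_one_part.
  exact: Pd.
exact: Pe.
Qed.

(** * Functors with the prescribed values are Lagrangian *)

Section LagrangianFunctor.
Variables (k : fieldType).
Variable K : smfunctor FinCorel (FinRel k) (fun n => n * 2).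

Lemma functor_tens m n m' n' (f : FinCorel m n) (g : FinCorel m' n') :
  fhom K (ptens f g) = dbl_tens (fhom K f) (fhom K g).
Proof.
rewrite /dbl_tens -(fhom_tens K) hcast_trans.
by rewrite (hcast_id (D := FinRel k)).
Qed.

Lemma functor_braid m n : fhom K (pbraid FinCorel m n) = dbl_braid k m n.
Proof.
rewrite /dbl_braid -(fhom_braid K) hcast_trans.
by rewrite (hcast_id (D := FinRel k)).
Qed.

Lemma subprop_lagrangian :
  subprop (C := FinCorel)
    (fun m n f => lagrangian_rel (kk_form k m) (kk_form k n) (fhom K f)).
Proof.
split=> [n|m n p f g Kf Kg|m n m' n' f g Kf Kg|m n].
- by rewrite fhom_id; exact: svalP (lag_id k n).
- by rewrite fhom_comp; exact: (lagrangian_comp Kf Kg).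
- by rewrite functor_tens; exact: (dbl_tens_lagrangian Kf Kg).
- by rewrite functor_braid; exact: dbl_braid_lagrangian.
Qed.

(** On each generator [K] agrees with the circuit functor, whose values are
    Lagrangian. *)
Lemma functor_lagrangian : generator_values K ->
  forall m n (f : FinCorel m n),
    lagrangian_rel (kk_form k m) (kk_form k n) (fhom K f).
Proof.
have [C1 C2 C3 C4] := circuit_generator_values k; case=> K1 K2 K3 K4.
have circuitE m n (f : FinCorel m n) :
    (forall u v, related (fhom K f) u v <-> related (circuit_rel k f) u v) ->
    lagrangian_rel (kk_form k m) (kk_form k n) (fhom K f).
  by move=> /lrel_eq->; exact: circuit_lagrangian.
apply: (corel_generated subprop_lagrangian); apply: circuitE => u v.
- exact: iff_trans (K1 u v) (iff_sym (C1 u v)).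
- exact: iff_trans (K2 u v) (iff_sym (C2 u v)).
- exact: iff_trans (K3 u v) (iff_sym (C3 u v)).
- exact: iff_trans (K4 u v) (iff_sym (C4 u v)).
Qed.

Section Corestriction.
Hypothesis Klag : forall m n (f : FinCorel m n),
  lagrangian_rel (kk_form k m) (kk_form k n) (fhom K f).

Definition lag_corestrict : prop_morphism FinCorel (LagRel k).
Proof.
refine (@MkFunctor FinCorel (LagRel k) id
  (fun m n f => exist _ (fhom K f) (Klag f)) erefl (fun _ _ => erefl) _ _ _ _).
- by move=> n; apply: lag_rel_inj; exact: (fhom_id K).
- by move=> m n p f g; apply: lag_rel_inj; exact: (fhom_comp K).
- by move=> m n m' n' f g; apply: lag_rel_inj; exact: functor_tens.
- by move=> m n; apply: lag_rel_inj; exact: functor_braid.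
Defined.

End Corestriction.
End LagrangianFunctor.

Theorem proposition4p1p6 (k : fieldType)
    (K : smfunctor FinCorel (FinRel k) (fun n => n * 2)) :
  generator_values K ->
  (forall (m n : nat) (f : FinCorel m n),
     lagrangian_rel (kk_form k m) (kk_form k n) (fhom K f)) /\
  (exists L : prop_morphism FinCorel (LagRel k),
     forall (m n : nat) (f : FinCorel m n), lag_rel (fhom L f) = fhom K f).
Proof.
move=> /functor_lagrangian Klag; split=> //.
by exists (lag_corestrict Klag).
Qed.
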